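(* Let $T_\tau>0$ and let $A:\mathbb{R}\to\mathbb{R}^{3\times 3}$, $B:\mathbb{R}\to\mathbb{R}^{3\times 1}$ be continuous $T_\tau$-periodic functions. Consider the linear time-varying system $$\frac{d\xi}{d\tau}=A(\tau)\xi+B(\tau)w,\qquad \xi\in\mathbb{R}^3,\ w\in\mathbb{R}.$$ Suppose that: (1) The unforced system $\frac{d\xi}{d\tau}=A(\tau)\xi$ admits a two-dimensional stable invariant subspace $$\mathcal{S}_\tau=\{\xi\in\mathbb{R}^3\mid n^\top(\tau)\,\xi=0\},\qquad \tau\in\mathbb{R},$$ where $n:\mathbb{R}\to S^2$ is continuous and $\mathcal{S}_{\tau+T_\tau}=\mathcal{S}_\tau$ for all $\tau$. That is, for every $\tau_o\in\mathbb{R}$, any solution of the unforced system with $\xi(\tau_o)=\xi_o\in\mathcal{S}_{\tau_o}$ satisfies $\xi(\tau)\in\mathcal{S}_\tau$ for all $\tau\ge\tau_o$ and $\xi(\tau)\to0$ as $\tau\to\infty$. (2) The scalar function $b(\tau)=n^\top(\tau)B(\tau)$ has finitely many isolated zeros in $[0,T_\tau]$, and each zero $\tau_z$ is simple, i.e. $\frac{db}{d\tau}(\tau_z)\neq0$. Let $\varepsilon>0$, $\sigma(b)=\frac{b}{|b|+\varepsilon}$, $s=n^\top(\tau)\,\xi$, and consider the feedback law $$w(\tau,\xi)=-\sigma\bigl(b(\tau)\bigr)\bigl(k_1\,\mathrm{sign}(s)+k_2\,s\bigr),$$ where $k_1>0$ and $$k_2>\frac{\int_0^{T_\tau}n^\top(\tau)A(\tau)n(\tau)\,d\tau}{\int_0^{T_\tau}b(\tau)\,\sigma\bigl(b(\tau)\bigr)\,d\tau}.$$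 Then the origin $\xi=0$ of the closed-loop system is globally asymptotically stable.
   Context: $S^2$ denotes the unit sphere in $\mathbb{R}^3$, so $\|n(\tau)\|=1$ for all $\tau$. The closed-loop system is the differential equation $\frac{d\xi}{d\tau}=A(\tau)\xi+B(\tau)w(\tau,\xi)$ with the given feedback; its right-hand side is discontinuous where $s=0$, and its solutions are understood in the sense of Filippov (i.e. at $s=0$ the value $\mathrm{sign}(s)$ is replaced by the interval $[-1,1]$, and solutions are absolutely continuous functions satisfying the resulting differential inclusion almost everywhere). Global asymptotic stability of the origin means that the origin is Lyapunov stable and every solution, from any initial time $\tau_o$ and any initial state $\xi_o\in\mathbb{R}^3$, converges to $0$ as $\tau\to\infty$. *)

(* Defs.v *)
From HB Require Import structures.
From mathcomp Require Import all_boot all_order all_algebra.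
From mathcomp Require Import all_classical all_reals all_analysis.
Set Implicit Arguments.
Unset Strict Implicit.
Unset Printing Implicit Defensive.
Import Order.TTheory GRing.Theory Num.Theory.
Import numFieldNormedType.Exports.

Local Open Scope classical_set_scope.
Local Open Scope ring_scope.

Definition dotv {R : realType} {m : nat} (u v : 'cV[R]_m) : R :=
  (u^T *m v) 0 0.

(* The sphere is Euclidean, so it is not the unit sphere of the library norm
   on ['cV[R]_m], which is the sup norm.  Everywhere else norms are only used
   for topological notions, where the choice is immaterial. *)
Definition unit_sphere {R : realType} {m : nat} : set 'cV[R]_m :=
  [set x | Num.sqrt (\sum_i x i 0 ^+ 2) = 1].

Definition abs_continuous {R : realType} {V : normedModType R}
    (a b : R) (f : R -> V) : Prop :=
  forall e : R, 0 < e -> exists2 d : R, 0 < d &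
    forall (k : nat) (u v : 'I_k -> R),
      (forall i, a <= u i /\ u i <= v i /\ v i <= b) ->
      trivIset setT (fun i => `]u i, v i[%classic) ->
      \sum_i (v i - u i) < d ->
      \sum_i `|f (v i) - f (u i)| < e.

Section DifferentialInclusion.
Context {R : realType} {V : normedModType R}.

Definition inclusion_solution (F : R -> V -> set V) (t0 : R) (x : R -> V)
    : Prop :=
  (forall t1, t0 < t1 -> abs_continuous t0 t1 x) /\
  {ae lebesgue_measure, forall t : R, t0 < t ->
     derivable x t 1 /\ F t (x t) (derive1 x t)}.

Definition lyapunov_stable (F : R -> V -> set V) : Prop :=
  forall (t0 e : R), 0 < e -> exists2 d : R, 0 < d &
    forall x, inclusion_solution F t0 x -> `|x t0| < d ->
      forall t, t0 <= t -> `|x t| < e.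

Definition globally_attractive (F : R -> V -> set V) : Prop :=
  forall (t0 : R) (x0 : V) (x : R -> V),
    inclusion_solution F t0 x -> x t0 = x0 -> x t @[t --> +oo] --> (0 : V).

Definition globally_asymptotically_stable (F : R -> V -> set V) : Prop :=
  lyapunov_stable F /\ globally_attractive F.

End DifferentialInclusion.

Section LinearSystem.
Context {R : realType} {m : nat}.

(* Classical solution of [x' = A x] on [[t0, +oo[]; continuity of [x] at [t0]
   and of [A] make the right derivative at [t0] satisfy the equation too. *)
Definition linear_solution (A : R -> 'M[R]_m) (t0 : R) (x : R -> 'cV[R]_m)
    : Prop :=
  {within `[t0, +oo[%classic, continuous x} /\
  forall t, t0 < t -> is_derive t (1 : R) x (A t *m x t).

Definition orth_plane (n : R -> 'cV[R]_m) (t : R) : set 'cV[R]_m :=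
  [set x | dotv (n t) x = 0].

Definition stable_invariant (A : R -> 'M[R]_m) (S : R -> set 'cV[R]_m)
    : Prop :=
  forall (t0 : R) (x : R -> 'cV[R]_m),
    linear_solution A t0 x -> S t0 (x t0) ->
    (forall t, t0 <= t -> S t (x t)) /\
    x t @[t --> +oo] --> (0 : 'cV[R]_m).

End LinearSystem.

Section ClosedLoop.
Context {R : realType}.

Definition sigma (eps b : R) : R := b / (`|b| + eps).

Definition filippov_sign (s : R) : set R :=
  if 0 < s then [set 1] else if s < 0 then [set -1] else `[-1, 1]%classic.

Definition feedback {m : nat} (B n : R -> 'cV[R]_m) (eps k1 k2 : R)
    (t : R) (x : 'cV[R]_m) : set R :=
  let b := dotv (n t) (B t) in
  let s := dotv (n t) x in
  [set - sigma eps b * (k1 * v + k2 * s) | v in filippov_sign s].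

Definition closed_loop {m : nat} (A : R -> 'M[R]_m) (B : R -> 'cV[R]_m)
    (w : R -> 'cV[R]_m -> set R) (t : R) (x : 'cV[R]_m) : set 'cV[R]_m :=
  [set A t *m x + u *: B t | u in w t x].

End ClosedLoop.

(* Main.v *)
Require Import Defs.
From HB Require Import structures.
From mathcomp Require Import all_boot all_order all_algebra.
From mathcomp Require Import all_classical all_reals all_analysis.
From mathcomp Require Import measurable_realfun ring lra.
Import Order.TTheory GRing.Theory Num.Theory.
Import numFieldNormedType.Exports.

Local Open Scope classical_set_scope.
Local Open Scope ring_scope.

(* Let [X] be the fundamental matrix of the unforced system at [t0] and
   [P = X^-T] that of the adjoint system.  Invariance of the planes forces
   [P t *m n t0 = exp (- int_t0^t n^T A n) *: n t], so with [g' = b sigma(b)]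
   and [h = exp (int_t0^t (k2 b sigma(b) - n^T A n))], the function
   [r = exp (k2 (g - g t0)) (n t0)^T P^T x] equals [h s] and satisfies
   [r' = - k1 b sigma(b) h v] with [v] in [sign r].  Hence [|r|] decreases at
   rate [k1 b sigma(b) h] until it vanishes, after which it stays zero.  The
   condition on [k2] makes [h (t + T) >= h t], so the rate has infinite integral
   and [r] vanishes in finite time.  From then on the control is zero almost
   everywhere, so [P^T x] is constant and [x] is a solution of the unforced
   system inside the stable plane.  For stability, the vanishing time tends to
   [t0] as [x t0] tends to 0, and meanwhile [P^T x] moves at bounded speed. *)

(** * Absolutely continuous functions *)

(** The normal [n] is only continuous, so [s] cannot be differentiated along a solution. In [r] the
    moving normal is replaced by the fixed vector [n t0] and the motion is carried by [P], which is
    derivable; since [h > 0], the identity [r = h s] gives [r] the sign of [s]. The factor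
    [exp (k2 (g - g t0))] is the integrating factor of the linear feedback term, which is why only
    the sign term survives in [r']. The rate [k1 b sigma(b) h] may vanish at zeros of [b], so the
    decay speed has no positive lower bound; the estimates go through a primitive [G] of the rate,
    strictly increasing because the zeros of [b] are simple. Periodicity of the planes determines
    [n] only up to sign after a period, hence the use of [b sigma(b)] and [n^T A n], which do not
    change when [n] is replaced by [- n]. Filippov solutions are only absolutely continuous, so
    monotonicity along them rests on a mean value inequality for derivatives known almost
    everywhere. *)

Section AbsoluteContinuity.
Context {R : realType}.
Implicit Types (f g : R -> R) (a b c e t u v : R) (U : set R).

(** Splitting the increment at [t] leaves two difference quotients based at [t], so derivability at
    this single point controls every short interval around it. *)
Lemma derive1_slope_bound f t e : 0 < e -> derivable f t 1 -> derive1 f t <= 0 ->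
  exists2 d, 0 < d & forall u v, t - d < u -> u <= t -> t <= v -> v < t + d ->
    f v - f u <= e * (v - u).
Proof.
move=> e0 df f'0; rewrite derive1E in f'0.
have : h^-1 *: (f (h *: 1 + t) - f t) @[h --> 0^'] --> 'D_1 f t by exact: df.
move/cvgrPdist_lt => /(_ _ e0)[d /= d0 dP].
have slope h : h != 0 -> `|h| < d -> h^-1 * (f (h + t) - f t) <= e.
  move=> h0 hd; apply/ltW.
  have := dP h; rewrite /ball_/= sub0r normrN hd => /(_ isT h0).
  rewrite ltr_norml => /andP[+ _].
  rewrite /GRing.scale/= mulr1 => ?; lra.
exists d => // u v du ut tv vd.
have fv : f v - f t <= e * (v - t).
  have [->|tv'] := eqVneq v t; first by rewrite !subrr mulr0.
  have vt0 : 0 < v - t by rewrite subr_gt0 lt_neqAle eq_sym tv'.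
  have := @slope (v - t) (lt0r_neq0 vt0).
  rewrite gtr0_norm// subrK ler_pdivrMl// mulrC => H; apply: H; lra.
have fu : f t - f u <= e * (t - u).
  have [->|ut'] := eqVneq u t; first by rewrite !subrr mulr0.
  have ut0 : u - t < 0 by rewrite subr_lt0 lt_neqAle ut'.
  have := @slope (u - t) (ltr0_neq0 ut0).
  rewrite ltr0_norm// subrK ler_ndivrMl//.
  move=> fut; suff : (u - t) * e <= f u - f t by lra.
  by apply: fut; lra.
lra.
Qed.

Lemma null_set_open_cover (N : set R) e : lebesgue_measure.-negligible N ->
  0 < e -> exists U, [/\ open U, N `<=` U & (lebesgue_measure U < e%:E)%E].
Proof.
move=> [M [mM M0 NM]] e0.
have [|U [oU MU Ue]] := @lebesgue_regularity_outer R M e mM _ e0.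
  by rewrite [ltLHS](_ : _ = 0%E) ?ltry//; exact: M0.
exists U; split => //; first exact: subset_trans MU.
rewrite -[U in lebesgue_measure U](setDUK MU) measureU//; last by rewrite setDIK.
  by rewrite [X in (X + _)%E](_ : _ = 0%E) ?add0e//; exact: M0.
by apply: measurableD => //; exact: open_measurable.
Qed.

Lemma sum_length_le_measure k (u v : 'I_k -> R) U : open U ->
  (forall i, u i <= v i) -> (forall i, `]u i, v i[ `<=` U) ->
  trivIset setT (fun i => `]u i, v i[%classic) ->
  ((\sum_i (v i - u i))%:E <= lebesgue_measure U)%E.
Proof.
move=> oU uv uvU tI.
rewrite -sumEFin (eq_bigr (fun i => lebesgue_measure (`]u i, v i[ : set R))).
  rewrite -(@measure_bigsetU_ord _ _ _ lebesgue_measure k xpredT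
    (fun i => `]u i, v i[%classic))//.
  apply: le_measure; rewrite ?inE.
  - by apply: bigsetU_measurable => i _; exact: measurable_itv.
  - exact: open_measurable.
  - by apply: (big_ind (fun A => A `<=` U)) => // A B AU BU x [/AU|/BU].
move=> i _; rewrite lebesgue_measure_itv/= lte_fin.
by case: ltgtP (uv i) => // ->; rewrite subrr.
Qed.

(* [x] is reachable when [f] increases on [[a, x]] by at most [e] times the
   length, up to its increments over disjoint intervals contained in [U]. *)
Let reachable f a e U x := exists k (u v : nat -> R),
  [/\ forall i, (i < k)%N ->
        [/\ a <= u i, u i <= v i, v i <= x & `]u i, v i[ `<=` U],
      forall i j, (i < j < k)%N -> v i <= u j &
      f x - f a <= e * (x - a) + \sum_(i < k) `|f (v i) - f (u i)| ].

Let reachable_step f a e U x y : 0 < e -> a <= x -> x <= y -> reachable f a e U x ->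
  `]x, y[ `<=` U \/ f y - f x <= e * (y - x) -> reachable f a e U y.
Proof.
move=> e0 ax xy [k [u [v [uv dis fx]]]] [xyU|fxy]; last first.
  exists k, u, v; split => //; last by lra.
  by move=> i ik; have [? ? ? ?] := uv i ik; split => //; lra.
exists k.+1, (fun i => if i == k then x else u i),
  (fun i => if i == k then y else v i); split.
- move=> i; rewrite ltnS leq_eqVlt => /predU1P[->|ik].
    by rewrite eqxx; split => //; lra.
  by rewrite (ltn_eqF ik); have [? ? ? ?] := uv i ik; split => //; lra.
- move=> i j /andP[ij]; rewrite ltnS leq_eqVlt => /predU1P[jk|jk].
    have ik : (i < k)%N by rewrite -jk.
    by rewrite jk eqxx (ltn_eqF ik); have [] := uv i ik.
  have ik : (i < k)%N := ltn_trans ij jk.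
  by rewrite (ltn_eqF ik) (ltn_eqF jk); apply: dis; rewrite ij.
- rewrite big_ord_recr/= eqxx (eq_bigr (fun i : 'I_k => `|f (v i) - f (u i)|)).
    have : e * (x - a) <= e * (y - a) by rewrite ler_pM2l//; lra.
    by have := ler_norm (f y - f x); lra.
  by move=> i _; rewrite ltn_eqF.
Qed.

(* Real induction along [[a, b]]: away from [U] the derivative controls the
   increments, and [U] covers the exceptional null set while being so small that
   absolute continuity makes the increments over it negligible. *)
Lemma ac_nonincreasing f a b : a <= b -> abs_continuous a b f ->
  {ae lebesgue_measure, forall t, a < t -> t < b ->
    derivable f t 1 /\ derive1 f t <= 0} ->
  f b <= f a.
Proof.
move=> ab acf df; apply/ler_addgt0Pr => e' e'0.
(* The slopes cost at most [e (b - a)] and the increments over [U] less than [e], which add up to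
   [e']. *)
pose e := e' / (b - a + 1).
have ba1 : 0 < b - a + 1 by lra.
have e0 : 0 < e by rewrite divr_gt0.
have [d d0 fd] := acf _ e0.
(* The endpoints join the exceptional set, since the derivative is controlled only strictly between
   them. *)
have : lebesgue_measure.-negligible (~` [set t | a < t -> t < b ->
    derivable f t 1 /\ derive1 f t <= 0] `|` ([set a] `|` [set b])).
  apply: negligibleU => //.
  by apply: negligibleU; apply/negligibleP => //;
    exact: lebesgue_measure_set1.
move=> /null_set_open_cover => /(_ d d0)[U [oU NU Ud]].
have local t : a <= t -> t <= b -> exists2 r, 0 < r &
    forall u v, t - r < u -> u <= t -> t <= v -> v < t + r ->
      `]u, v[ `<=` U \/ f v - f u <= e * (v - u).
  move=> at_ tb; have [Ut|Ut] := pselect (U t).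
    have /nbhs_ballP[r /= r0 rU] := open_nbhs_nbhs (conj oU Ut).
    exists r => // u v tu _ _ vt; left => z /=; rewrite in_itv/= => /andP[uz zv].
    by apply: rU; rewrite /ball/= ltr_norml; apply/andP; split; lra.
  have /not_orP[/contrapT dft /not_orP[/= ta tb']] :=
    contra_not (NU t) Ut.
  have [||dft1 dft2] := dft.
  - by rewrite lt_neqAle at_ andbT; apply/eqP => /esym.
  - by rewrite lt_neqAle tb andbT; apply/eqP.
  have [r r0 rP] := derive1_slope_bound f t e e0 dft1 dft2.
  by exists r => // u v *; right; exact: rP.
pose S := [set x | [/\ a <= x, x <= b & reachable f a e U x]].
have Sa : S a.
  split => //; exists 0%N, (fun=> 0), (fun=> 0); split => //.
  by rewrite big_ord0 !subrr mulr0 addr0.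
have supS : has_sup S by split; [exists a | exists b => x []].
pose c := sup S.
have ac : a <= c by apply: ub_le_sup => //; exact: supS.2.
have cb : c <= b by apply: ge_sup; [exists a | move=> x []].
have [r r0 rP] := local c ac cb.
have [x [ax xb Sx] cx] := sup_adherent r0 supS.
have xc : x <= c by apply: ub_le_sup => //; exact: supS.2.
(* One step from [x], at or just below the supremum [c], leads across [c] to [y]. So [y] belongs to
   [S] and [y <= c], which forces [y = b]. *)
pose y := Order.min b (c + r / 2).
have cy : c <= y by rewrite le_min cb/=; lra.
have yb : y <= b by rewrite ge_min lexx.
have yr : y < c + r by rewrite gt_min; apply/orP; right; lra.
have Sy : S y.
  split; [lra|by []|].
  by apply: (reachable_step _ _ _ _ x) => //; [lra | exact: rP].
have yc : y <= c by apply: ub_le_sup => //; exact: supS.2.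
have ybE : y = b.
  by move: yc; rewrite /y minElt; case: ifPn => // _; lra.
rewrite ybE in Sy => {supS}.
case: Sy => _ _ [k [u [v [uv dis fb]]]].
have tI : trivIset setT (fun i : 'I_k => `]u i, v i[%classic).
  apply/trivIsetP => i j _ _; wlog ij : i j / (i < j)%N.
    move=> H; rewrite neq_ltn => /orP[] ij; [|rewrite setIC];
    by apply: H => //; rewrite neq_ltn ij.
  move=> _; rewrite -subset0 => z [] /=; rewrite !in_itv/=.
  move=> /andP[_ zi] /andP[zj _].
  by have := dis i j; rewrite ij/= => /(_ (ltn_ord _)) ?; lra.
have sume : \sum_(i < k) `|f (v i) - f (u i)| < e.
  apply: (fd k (fun i => u i) (fun i => v i)) => //.
    by move=> i; have [? ? ? ?] := uv i (ltn_ord i); split => //; split => //; lra.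
  rewrite -lte_fin (le_lt_trans _ Ud)//.
  apply: sum_length_le_measure => // i; by have [] := uv i (ltn_ord i).
have : e * (b - a + 1) = e' by rewrite /e divfK// gt_eqF.
lra.
Qed.

End AbsoluteContinuity.

(** * Operations on absolutely continuous functions and mean value inequalities *)

Section AbsoluteContinuityAlgebra.
Context {R : realType}.
Implicit Types (f g : R -> R) (a b c e t u v K : R).

Lemma ae_lebesgue_imply (P Q : R -> Prop) : (forall t, P t -> Q t) ->
  {ae lebesgue_measure, forall t, P t} -> {ae lebesgue_measure, forall t, Q t}.
Proof.
move=> PQ; apply: filterS => //.
exact: (ae_filter_ringOfSetsType lebesgue_measure).
Qed.

Lemma abs_continuous_sub (V : normedModType R) (f : R -> V) a b a' b' :
  a <= a' -> b' <= b -> abs_continuous a b f -> abs_continuous a' b' f.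
Proof.
move=> aa' bb' fab e /fab[d d0 fd]; exists d => // k u v uv; apply: fd => i.
by have [? [? ?]] := uv i; split; [lra|split => //; lra].
Qed.

Lemma lipschitz_abs_continuous f a b K :
  (forall u v, a <= u -> u <= v -> v <= b -> `|f v - f u| <= K * (v - u)) ->
  abs_continuous a b f.
Proof.
move=> fK e e0; pose L := `|K| + 1.
have L0 : 0 < L by rewrite /L; have := normr_ge0 K; lra.
exists (e / L); first exact: divr_gt0.
move=> k u v uv _ uvd; apply: (@le_lt_trans _ _ (\sum_i L * (v i - u i))).
  apply: ler_sum => i _; have [au [uvi vb]] := uv i.
  apply: (le_trans (fK _ _ au uvi vb)); rewrite ler_wpM2r ?subr_ge0//.
  by rewrite /L; have := ler_norm K; lra.
by rewrite -mulr_sumr mulrC -ltr_pdivlMr.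
Qed.

Lemma abs_continuousD f g a b : abs_continuous a b f -> abs_continuous a b g ->
  abs_continuous a b (f \+ g).
Proof.
move=> fac gac e e0.
have [d d0 fd] := fac _ (divr_gt0 e0 (ltr0n R 2)).
have [d' d'0 gd] := gac _ (divr_gt0 e0 (ltr0n R 2)).
exists (Order.min d d'); first by rewrite lt_min d0.
move=> k u v uv tI; rewrite lt_min => /andP[/(fd k u v uv tI) fe].
move=> /(gd k u v uv tI) ge; rewrite [e]splitr.
apply: le_lt_trans (ltrD fe ge); rewrite -big_split/=; apply: ler_sum => i _.
by rewrite opprD addrACA ler_normD.
Qed.

Lemma abs_continuous_cst c a b : abs_continuous a b (fun=> c).
Proof.
by apply: (@lipschitz_abs_continuous _ _ _ 0) => *; rewrite subrr normr0 mul0r.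
Qed.

Lemma abs_continuous_sum (n : nat) (F : 'I_n -> R -> R) a b :
  (forall i, abs_continuous a b (F i)) ->
  abs_continuous a b (fun t => \sum_i F i t).
Proof.
elim: n F => [F _|n IH F Fac].
  by under eq_fun do rewrite big_ord0; exact: abs_continuous_cst.
under eq_fun do rewrite big_ord_recr/=.
apply: (abs_continuousD (fun t => \sum_(i < n) F (widen_ord (leqnSn n) i) t)) => //.
exact: IH.
Qed.

Lemma abs_continuous_within f a b : abs_continuous a b f ->
  {within `[a, b], continuous f}.
Proof.
move=> fac; apply/subspace_continuousP => t; rewrite /= in_itv/= => /andP[at_ tb].
apply/cvgrPdist_lt => e e0; have [d d0 fd] := fac _ e0.
have key p q : a <= p -> p <= q -> q <= b -> q - p < d -> `|f q - f p| < e.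
  move=> ap pq qb pqd; have := fd 1%N (fun=> p) (fun=> q); rewrite !big_ord1.
  by apply => //; move=> i j _ _ _; rewrite !ord1.
near=> s.
have ts : `|t - s| < d by near: s; apply: cvg_within; apply/nbhs_ballP; exists d.
have : `[a, b]%classic s by near: s; exact: withinT.
rewrite /= in_itv/= => /andP[as_ sb].
have [st|/ltW st] := leP s t; [|rewrite distrC]; apply: key => //.
  by rewrite ger0_norm ?subr_ge0// in ts.
by rewrite ler0_norm ?subr_le0// opprB in ts.
Unshelve. all: by end_near. Qed.

Lemma within_continuous_bounded f a b : {within `[a, b], continuous f} ->
  exists2 M, 0 < M & forall t, a <= t -> t <= b -> `|f t| <= M.
Proof.
move=> fc; have [ab|ba] := leP a b; last by exists 1 => // t ? ?; lra.
have nfc : {within `[a, b], continuous (fun t => `|f t|)}.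
  by move=> x; apply: continuous_comp; [exact: fc|exact: norm_continuous].
have [c _ cmax] := EVT_max ab nfc.
exists (`|f c| + 1) => [|t at_ tb]; first by have := normr_ge0 (f c); lra.
by have := cmax t; rewrite in_itv/= at_ tb => /(_ isT); lra.
Qed.

Lemma abs_continuousM f g a b : abs_continuous a b f -> abs_continuous a b g ->
  abs_continuous a b (f \* g).
Proof.
move=> fac gac e e0.
have [M M0 fM] := within_continuous_bounded _ _ _ (abs_continuous_within _ _ _ fac).
have [N N0 gN] := within_continuous_bounded _ _ _ (abs_continuous_within _ _ _ gac).
have [d d0 fd] := fac _ (divr_gt0 (divr_gt0 e0 (ltr0n R 2)) N0).
have [d' d'0 gd] := gac _ (divr_gt0 (divr_gt0 e0 (ltr0n R 2)) M0).
exists (Order.min d d'); first by rewrite lt_min d0.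
move=> k u v uv tI; rewrite lt_min => /andP[/(fd k u v uv tI) fe].
move=> /(gd k u v uv tI) ge; rewrite [e]splitr.
rewrite ltr_pdivlMr// in fe; rewrite ltr_pdivlMr// in ge.
apply: le_lt_trans (ltrD fe ge).
rewrite !mulr_suml -big_split/=; apply: ler_sum => i _.
have [au [uvi vb]] := uv i.
rewrite (_ : _ - _ = (f (v i) - f (u i)) * g (v i)
                     + (g (v i) - g (u i)) * f (u i)); last by ring.
rewrite (le_trans (ler_normD _ _))// !normrM lerD// ler_wpM2l// ?fM ?gN//; lra.
Qed.

Lemma abs_continuous_coord (m n : nat) (x : R -> 'M[R]_(m.+1, n.+1)) a b i j :
  abs_continuous a b x -> abs_continuous a b (fun t => x t i j).
Proof.
move=> xac e e0; have [d d0 xd] := xac e e0; exists d => // k u v uv tI uvd.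
apply: le_lt_trans (xd k u v uv tI uvd); apply: ler_sum => l _.
rewrite [leRHS]/Num.Def.normr/= mx_normrE.
by apply: le_trans (le_bigmax _ _ (i, j)); rewrite !mxE.
Qed.

Lemma derivative_bound_lipschitz f df a b K :
  {within `[a, b], continuous f} ->
  (forall t, a < t -> t < b -> is_derive t (1 : R) f (df t)) ->
  (forall t, a <= t -> t <= b -> `|df t| <= K) ->
  forall u v, a <= u -> u <= v -> v <= b -> `|f v - f u| <= K * (v - u).
Proof.
move=> fc fdf dfK u v au uv vb.
have [t||c + ->] := @MVT_segment _ f df _ _ uv.
- by rewrite in_itv/= => /andP[? ?]; apply: fdf; lra.
- by apply: continuous_subspaceW fc; apply: subset_itv; rewrite bnd_simp.
- rewrite in_itv/= => /andP[uc cv].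
  rewrite normrM (ger0_norm (_ : 0 <= v - u)) ?subr_ge0//.
  by rewrite ler_wpM2r ?subr_ge0// dfK//; lra.
Qed.

Lemma ac_derive_le f a b K : a <= b -> abs_continuous a b f ->
  {ae lebesgue_measure, forall t, a < t -> t < b ->
    exists2 l, l <= K & is_derive t (1 : R) f l} ->
  f b - f a <= K * (b - a).
Proof.
move=> ab fac fK.
pose g := f \+ (fun t => - K * t).
have gac : abs_continuous a b g.
  apply: abs_continuousD => //; apply: (@lipschitz_abs_continuous _ _ _ `|K|).
  move=> u v _ uv _; rewrite -mulrBr normrM normrN ler_wpM2l//.
  by rewrite ger0_norm ?subr_ge0.
suff : g b <= g a by rewrite /g/=; lra.
apply: ac_nonincreasing => //; apply: ae_lebesgue_imply fK => t H at_ tb.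
have [l lK dfl] := H at_ tb.
have dg : is_derive t (1 : R) g (l + - K * 1).
  apply: is_deriveD; apply: (@is_deriveZ _ _ _ id).
by split; [exact: ex_derive|rewrite derive1E derive_val; lra].
Qed.

Lemma ac_derive_norm_le f a b K : a <= b -> abs_continuous a b f ->
  {ae lebesgue_measure, forall t, a < t -> t < b ->
    exists2 l, `|l| <= K & is_derive t (1 : R) f l} ->
  `|f b - f a| <= K * (b - a).
Proof.
move=> ab fac fK; rewrite ler_norml; apply/andP; split; last first.
  apply: ac_derive_le => //; apply: ae_lebesgue_imply fK => t H at_ tb.
  by have [l + ?] := H at_ tb; exists l => //; have := ler_norm l; lra.
have Nfac : abs_continuous a b (fun t => -1 * f t).
  by apply: abs_continuousM => //; exact: abs_continuous_cst.
suff : -1 * f b - (-1 * f a) <= K * (b - a) by lra.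
apply: (ac_derive_le (fun t => -1 * f t)) => //.
apply: ae_lebesgue_imply fK => t H at_ tb.
have [l lK df] := H at_ tb; exists (-1 * l); last exact: is_deriveZ.
by have := ler_norm (- l); rewrite normrN; lra.
Qed.

End AbsoluteContinuityAlgebra.

(** * Derivatives and primitives *)

Section DerivativeFacts.
Context {R : realType}.
Implicit Types (f g : R -> R) (a b c t : R).

Lemma is_derive_addf t f g df dg : is_derive t (1 : R) f df ->
  is_derive t (1 : R) g dg -> is_derive t (1 : R) (fun s => f s + g s) (df + dg).
Proof. exact: is_deriveD. Qed.

Lemma is_derive_subf t f g df dg : is_derive t (1 : R) f df ->
  is_derive t (1 : R) g dg -> is_derive t (1 : R) (fun s => f s - g s) (df - dg).
Proof. exact: is_deriveB. Qed.

Lemma is_derive_oppf t f df : is_derive t (1 : R) f df ->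
  is_derive t (1 : R) (fun s => - f s) (- df).
Proof. exact: is_deriveN. Qed.

Lemma is_derive_mulf t f g df dg : is_derive t (1 : R) f df ->
  is_derive t (1 : R) g dg ->
  is_derive t (1 : R) (fun s => f s * g s) (df * g t + f t * dg).
Proof.
move=> df' dg'; rewrite (_ : _ + _ = f t *: dg + g t *: df).
  exact: is_deriveM.
by rewrite /GRing.scale/=; ring.
Qed.

Lemma is_derive_cstf t c : is_derive t (1 : R) (fun=> c) 0.
Proof. exact: is_derive_cst. Qed.

Lemma is_derive_expf t f df : is_derive t (1 : R) f df ->
  is_derive t (1 : R) (fun s => expR (f s)) (df * expR (f t)).
Proof. by move=> ?; rewrite mulrC; exact: is_derive1_comp. Qed.

Lemma is_derive_sumf (n : nat) (F : 'I_n -> R -> R) (dF : 'I_n -> R) t :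
  (forall i, is_derive t (1 : R) (F i) (dF i)) ->
  is_derive t (1 : R) (fun s => \sum_i F i s) (\sum_i dF i).
Proof.
move=> dFF; rewrite (_ : (fun s => _) = \sum_i F i); first exact: is_derive_sum.
by apply/funext => s; rewrite fct_sumE.
Qed.

Lemma is_derive_shiftf t c f df : is_derive (t + c) (1 : R) f df ->
  is_derive t (1 : R) (fun s => f (s + c)) df.
Proof.
move=> dff; rewrite -[df]mulr1.
apply: (@is_derive1_comp _ _ (fun s => s + c)) => //.
by rewrite -[X in is_derive _ _ _ X]addr0; apply: is_derive_addf.
Qed.

Lemma is_derive_continuous t f df : is_derive t (1 : R) f df ->
  {for t, continuous f}.
Proof.
by move=> dff; apply/differentiable_continuous/derivable1_diffP; exact: ex_derive.
Qed.

Lemma continuous_sumf (T : topologicalType) (n : nat) (F : 'I_n -> T -> R) :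
  (forall i, continuous (F i)) -> continuous (fun x => \sum_i F i x).
Proof.
elim: n F => [F _|n IH F Fc] x.
  by under eq_fun do rewrite big_ord0; exact: cvg_cst.
under eq_fun do rewrite big_ord_recr/=.
by apply: cvgD; [apply: IH|apply: Fc].
Qed.

Lemma ge0_derive_le f df a b : a <= b -> {within `[a, b], continuous f} ->
  (forall t, a < t -> t < b -> is_derive t (1 : R) f (df t)) ->
  (forall t, a <= t -> t <= b -> 0 <= df t) -> f a <= f b.
Proof.
move=> ab fc dff df0; have [t||c + fE] := @MVT_segment _ f df _ _ ab => //.
  by rewrite in_itv/= => /andP[]; exact: dff.
rewrite in_itv/= => /andP[? ?]; rewrite -subr_ge0 fE mulr_ge0 ?df0//; lra.
Qed.

Lemma derive_eq0_cst f a b : a <= b -> {within `[a, b], continuous f} ->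
  (forall t, a < t -> t < b -> is_derive t (1 : R) f 0) -> f b = f a.
Proof.
move=> ab fc dff; have := derivative_bound_lipschitz f (fun=> 0) a b 0 fc dff.
move=> /(_ _ a b); rewrite mul0r normr0 !lexx ab => /(_ _ _ _ _).
by move=> H; apply/eqP; rewrite -subr_eq0 -normr_le0 H.
Qed.

Let antiderivative_above f a : continuous f ->
  exists F : R -> R, forall t, a < t -> is_derive t (1 : R) F (f t).
Proof.
move=> fc; exists (fun x => (\int[lebesgue_measure]_(t in `[a, x]) f t)%R) => t at_.
have tt : t < t + 1 by lra.
have intf : lebesgue_measure.-integrable `[a, t + 1] (EFin \o f).
  apply: continuous_compact_integrable; first exact: segment_compact.
  exact: continuous_subspaceT.
have [dF fE] := continuous_FTC1_closed tt intf at_ (fc t).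
by have := derivableP dF; rewrite -derive1E fE.
Qed.

(** An integral with variable upper bound is a primitive only to the right of its base point. A
    second one, reflected by [t -> - t], covers the left; on the overlap the two differ by a
    constant and can be glued. A primitive on the whole line is wanted because [t0] is arbitrary
    while the condition on [k2] concerns [[0, T]]. *)
Lemma antiderivative f : continuous f ->
  exists F : R -> R, forall t, is_derive t (1 : R) F (f t).
Proof.
move=> fc; have [F Ff] := antiderivative_above _ (-1) fc.
have [G Gf] : exists G : R -> R, forall t, -1 < t -> is_derive t (1 : R) G (f (- t)).
  apply: antiderivative_above => t.
  by apply: continuous_comp; [exact: opp_continuous|exact: fc].
pose H (t : R) : R := - G (- t).
have Hf (t : R) : t < 1 -> is_derive t (1 : R) H (f t).
  move=> t1; rewrite (_ : f t = - (f (- - t) * -1)); last by rewrite opprK; ring.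
  by apply: is_deriveN; apply: is_derive1_comp; apply: Gf; lra.
have FH (t : R) : -1 < t -> t < 1 -> F t - H t = F 0 - H 0.
  move=> t_gt t_lt; pose D (s : R) : R := F s - H s.
  have dD (s : R) : -1 < s -> s < 1 -> is_derive s (1 : R) D 0.
    move=> s1 s2; rewrite -(subrr (f s)).
    exact: (is_derive_subf _ _ _ _ _ (Ff s s1) (Hf s s2)).
  have cD (u v : R) : -1 < u -> v < 1 -> {within `[u, v], continuous D}.
    move=> u1 v1; apply: continuous_in_subspaceT => s; rewrite inE/= in_itv/=.
    by move=> /andP[us sv]; apply: is_derive_continuous; apply: dD; lra.
  have [t0|/ltW t0] := leP 0 t.
    by apply: (derive_eq0_cst D) => //; [apply: cD; lra|move=> *; apply: dD; lra].
  by apply/esym/(derive_eq0_cst D) => //; [apply: cD; lra|move=> *; apply: dD; lra].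
(* The switch at [1/2] lies inside the overlap []-1, 1[], so both formulas agree around the
   junction. *)
exists (fun t => if t < 2^-1 then H t else F t - (F 0 - H 0)) => t.
have [t2|t2] := ltP t 2^-1.
  apply: near_eq_is_derive (Hf t _); last by lra.
  near=> s; rewrite ifT//; near: s; exact: lt_nbhsl.
have dF : is_derive t (1 : R) (fun s => F s - (F 0 - H 0)) (f t).
  have t1 : -1 < t by lra.
  rewrite -[f t]subr0.
  exact: (is_derive_subf _ _ _ _ _ (Ff t t1) (is_derive_cstf t _)).
apply: near_eq_is_derive dF; near=> s.
case: ifPn => // s2; rewrite -(FH s); first by ring.
- suff : 0 < s by lra.
  by near: s; apply: lt_nbhsr; lra.
- lra.
Unshelve. all: by end_near. Qed.

End DerivativeFacts.

(** * Linear differential equations *)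

Section LinearODE.
Context {R : realType}.

(** The radius [r k] is the sum of the remaining step bounds, so the intervals of radius [r k]
    around [u k] are nested and the supremum of their left ends lies in all of them. The explicit
    error makes the convergence of the Picard iterates uniform on left half-lines. *)
Lemma geometric_sequence_limit (u : nat -> R) c : 0 <= c ->
  (forall k, `|u k.+1 - u k| <= c / 2 ^+ k) ->
  exists x, forall k, `|x - u k| <= 2 * c / 2 ^+ k.
Proof.
move=> c0 uc; pose r k := 2 * c / 2 ^+ k.
have r0 k : 0 <= r k by rewrite /r divr_ge0 ?mulr_ge0 ?exprn_ge0.
have rS k : r k.+1 = r k - c / 2 ^+ k.
  by rewrite /r exprS; field; rewrite expf_neq0.
have step k : u k - r k <= u k.+1 - r k.+1 /\ u k.+1 + r k.+1 <= u k + r k.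
  by have := uc k; rewrite rS ler_norml => /andP[? ?]; split; lra.
have mono j k : u j - r j <= u (j + k)%N - r (j + k)%N /\
                u (j + k)%N + r (j + k)%N <= u j + r j.
  elim: k => [|k [IH1 IH2]]; first by rewrite addn0.
  by rewrite addnS; have [? ?] := step (j + k)%N; split; lra.
have cross j k : u j - r j <= u k + r k.
  have [/subnKC <-|/ltnW/subnKC <-] := leqP j k.
    by have [? ?] := mono j (k - j)%N; have := r0 (j + (k - j))%N; lra.
  by have [? ?] := mono k (j - k)%N; have := r0 (k + (j - k))%N; lra.
pose S := range (fun k => u k - r k).
have supS : has_sup S.
  split; first by exists (u 0%N - r 0%N), 0%N.
  by exists (u 0%N + r 0%N) => _ [k _ <-].
exists (sup S) => k; rewrite -/(r k).
have : u k - r k <= sup S by apply: ub_le_sup; [exact: supS.2|exists k].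
have : sup S <= u k + r k by apply: ge_sup; [exact: supS.1|move=> _ [j _ <-]].
by rewrite ler_norml => ? ?; apply/andP; split; lra.
Qed.

Lemma lt_geometric_half (c e : R) : 0 < e -> exists k, c / 2 ^+ k < e.
Proof.
move=> e0; exists (Num.bound (c / e)).
have pow0 : (0 : R) < 2 ^+ Num.bound (c / e) by rewrite exprn_gt0.
have [c0|c0] := leP c 0.
  by apply: le_lt_trans e0; rewrite ler_pdivrMr// mul0r.
rewrite ltr_pdivrMr// mulrC -ltr_pdivrMr//.
apply: lt_trans (archi_boundP _) _; first by rewrite divr_ge0 ?ltW.
by rewrite -natrX ltr_nat ltn_expl.
Qed.

Let ltr_dist_thirds (a b c d e : R) : `|a - b| < e / 3 -> `|c - d| < e / 3 ->
  `|b - d| < e / 3 -> `|a - c| < e.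
Proof.
rewrite !ltr_norml => /andP[? ?] /andP[? ?] /andP[? ?].
by apply/andP; split; lra.
Qed.

(* [w] is a difference of consecutive Picard iterates; the exponential weight
   makes the integral operator a contraction of ratio 1/2 globally in time. *)
Let weighted_bound (w dw : R -> R) (t0 c L : R) : 0 <= L -> 0 <= c ->
  continuous w -> w t0 = 0 ->
  (forall t, t0 < t -> is_derive t (1 : R) w (dw t)) ->
  (forall t, t0 <= t -> `|dw t| <= c * (L * expR (L * (t - t0)))) ->
  forall t, t0 <= t -> `|w t| <= c * expR (L * (t - t0)).
Proof.
move=> L0 c0 wc w0 dww wb t t0t.
pose E s := c * expR (L * (s - t0)).
have dE s : is_derive s (1 : R) E (c * (L * expR (L * (s - t0)))).
  rewrite /E (_ : c * _ = 0 * expR (L * (s - t0)) +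
     c * ((0 * (s - t0) + L * (1 - 0)) * expR (L * (s - t0)))); last by ring.
  have d1 := is_derive_subf _ _ _ _ _ (is_derive_id s (1 : R)) (is_derive_cstf s t0).
  have d2 := is_derive_mulf _ _ _ _ _ (is_derive_cstf s L) d1.
  exact: is_derive_mulf _ _ _ _ _ (is_derive_cstf s c) (is_derive_expf _ _ _ d2).
have cE s : {for s, continuous E} := is_derive_continuous _ _ _ (dE s).
have Et0 : E t0 = c by rewrite /E subrr mulr0 expR0 mulr1.
rewrite ler_norml; apply/andP; split.
- have : E t0 + w t0 <= E t + w t.
    apply: (ge0_derive_le (fun s => E s + w s)
      (fun s => c * (L * expR (L * (s - t0))) + dw s) _ _ t0t).
    + by apply: continuous_subspaceT => s; apply: cvgD; [exact: cE|exact: wc].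
    + by move=> s t0s _; exact: is_derive_addf _ _ _ _ _ (dE s) (dww s t0s).
    + by move=> s t0s _; have := wb s t0s; rewrite ler_norml => /andP[]; lra.
  by rewrite Et0 w0 -/(E t); lra.
- have : E t0 - w t0 <= E t - w t.
    apply: (ge0_derive_le (fun s => E s - w s)
      (fun s => c * (L * expR (L * (s - t0))) - dw s) _ _ t0t).
    + by apply: continuous_subspaceT => s; apply: cvgB; [exact: cE|exact: wc].
    + by move=> s t0s _; exact: is_derive_subf _ _ _ _ _ (dE s) (dww s t0s).
    + by move=> s t0s _; have := wb s t0s; rewrite ler_norml => /andP[]; lra.
  by rewrite Et0 w0 -/(E t); lra.
Qed.


Variables (n : nat) (A : R -> 'M[R]_n) (K t0 : R) (x0 : 'I_n -> R).
Hypothesis Ac : forall i j, continuous (fun t => A t i j).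
Hypothesis AK : forall t i j, `|A t i j| <= K.

Let primitive (f : R -> R) : R -> R :=
  xget (fun=> 0) [set F | forall t, is_derive t (1 : R) F (f t)].

Let primitiveP f : continuous f ->
  forall t, is_derive t (1 : R) (primitive f) (f t).
Proof. by move=> /antiderivative fc; exact: (xgetPex (fun=> 0) fc). Qed.

Let rhs (x : 'I_n -> R -> R) i t : R := \sum_j A t i j * x j t.

(** Picard operator, frozen at [x0] before [t0] by the maximum, so that iterates are continuous on
    the whole line. *)
Let step (x : 'I_n -> R -> R) i t : R :=
  x0 i + (primitive (rhs x i) (Order.max t t0) - primitive (rhs x i) t0).

Let rhs_continuous x : (forall i, continuous (x i)) ->
  forall i, continuous (rhs x i).
Proof.
move=> xc i; apply: continuous_sumf => j t.
by apply: cvgM; [exact: Ac|exact: xc].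
Qed.

Let step_t0 x i t : t <= t0 -> step x i t = x0 i.
Proof. by move=> tt0; rewrite /step max_r// subrr addr0. Qed.

Let step_continuous x : (forall i, continuous (x i)) ->
  forall i, continuous (step x i).
Proof.
move=> xc i t; apply: cvgD; first exact: cvg_cst.
apply: cvgB; last exact: cvg_cst.
apply: (@continuous_comp _ _ _ (fun t => Order.max t t0)).
  by apply: (@continuous_max _ _ id (cst t0)); [exact: cvg_id|exact: cvg_cst].
exact: is_derive_continuous _ _ _ (primitiveP _ (rhs_continuous _ xc i) _).
Qed.

Let step_derive x : (forall i, continuous (x i)) ->
  forall i t, t0 < t -> is_derive t (1 : R) (step x i) (rhs x i t).
Proof.
move=> xc i t t0t.
have dp := primitiveP _ (rhs_continuous _ xc i) t.
have d : is_derive t (1 : R)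
    (fun s => x0 i + (primitive (rhs x i) s - primitive (rhs x i) t0)) (rhs x i t).
  rewrite -[rhs x i t]add0r -[rhs x i t]subr0.
  exact: is_derive_addf _ _ _ _ _ (is_derive_cstf t _)
    (is_derive_subf _ _ _ _ _ dp (is_derive_cstf t _)).
apply: near_eq_is_derive d; near=> s; rewrite /step max_l//.
by apply/ltW; near: s; exact: lt_nbhsr.
Unshelve. all: by end_near. Qed.

(** [n K] is a Lipschitz constant of [rhs] for the largest coordinate; doubling it in the weight
    gives the ratio 1/2. *)
Let L := 2 * (n%:R * K).
Let w t := expR (L * (Order.max t t0 - t0)).

Let rhs_bound x y c t : (forall i, `|x i t - y i t| <= c) ->
  forall i, `|rhs x i t - rhs y i t| <= (n%:R * K) * c.
Proof.
move=> xyc i; rewrite /rhs -sumrB (le_trans (ler_norm_sum _ _ _))//.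
apply: (@le_trans _ _ (\sum_(j < n) K * c)); last first.
  by rewrite sumr_const card_ord -mulrA mulr_natl.
apply: ler_sum => j _; rewrite -mulrBr normrM.
by rewrite ler_pM// ?xyc ?AK.
Qed.

Let step_bound x y c : 0 <= c ->
  (forall i, continuous (x i)) -> (forall i, continuous (y i)) ->
  (forall i t, `|x i t - y i t| <= c * w t) ->
  forall i t, `|step x i t - step y i t| <= c / 2 * w t.
Proof.
move=> c0 xc yc xyc i t.
have L0 : 0 <= L.
  rewrite /L mulr_ge0// mulr_ge0//; exact: le_trans (normr_ge0 _) (AK t i i).
have [tt0|/ltW t0t] := leP t t0.
  by rewrite !step_t0// subrr normr0 mulr_ge0 ?divr_ge0// expR_ge0.
rewrite /w max_l//.
apply: (weighted_bound (fun t => step x i t - step y i t)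
  (fun t => rhs x i t - rhs y i t)) t0t.
- exact: L0.
- by rewrite divr_ge0.
- by move=> s; apply: cvgB; exact: step_continuous.
- by rewrite !step_t0// subrr.
- move=> s t0s; exact: is_derive_subf _ _ _ _ _ (step_derive x xc i s t0s)
    (step_derive y yc i s t0s).
- move=> s t0s; apply: (le_trans (rhs_bound x y (c * w s) s (fun i => xyc i s) i)).
  by rewrite /w max_l// /L le_eqVlt; apply/orP; left; apply/eqP; field.
Qed.

Let iterate k := iter k step (fun _ => fun=> 0).

Let iterate_continuous k i : continuous (iterate k i).
Proof.
elim: k i => [|k IH] i; first by move=> t; exact: cvg_cst.
exact: step_continuous IH i.
Qed.

Lemma linear_ode_solution : exists x : 'I_n -> R -> R,
  [/\ forall i, continuous (x i), forall i, x i t0 = x0 i &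
      forall i t, t0 < t ->
        is_derive t (1 : R) (x i) (\sum_j A t i j * x j t)].
Proof.
have L0 (i : 'I_n) : 0 <= L.
  rewrite /L mulr_ge0// mulr_ge0//; exact: le_trans (normr_ge0 _) (AK t0 i i).
have w1 (i : 'I_n) t : 1 <= w t.
  rewrite /w -[leLHS]expR0 ler_expR mulr_ge0 ?(L0 i)// subr_ge0.
  by rewrite le_max lexx orbT.
pose C := \sum_i `|x0 i|.
have C0 : 0 <= C by apply: sumr_ge0.
have step0 i t : step (fun _ => fun=> 0) i t = x0 i.
  have [tt0|/ltW t0t] := leP t t0; first exact: step_t0.
  have c0 (j : 'I_n) : continuous ((fun=> fun=> 0) j : R -> R).
    by move=> ?; exact: cvg_cst.
  rewrite -(step_t0 (fun _ => fun=> 0) i t0 (lexx _)).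
  apply: derive_eq0_cst t0t _ _.
    by apply: continuous_subspaceT; exact: step_continuous.
  move=> s t0s _; have := step_derive _ c0 i s t0s.
  rewrite (_ : rhs _ i s = 0)//.
  by rewrite /rhs big1// => j _; rewrite mulr0.
have iterateB k i t : `|iterate k.+1 i t - iterate k i t| <= C / 2 ^+ k * w t.
  elim: k i t => [|k IH] i t.
    rewrite /= step0 subr0 expr0 divr1 -[leLHS]mulr1 ler_pM ?(w1 i)//.
    by rewrite /C (bigD1 i)//= lerDl sumr_ge0.
  rewrite exprSr invfM mulrA.
  have Ck : 0 <= C / 2 ^+ k by rewrite divr_ge0 ?exprn_ge0.
  exact: (step_bound _ _ _ Ck (iterate_continuous k.+1) (iterate_continuous k) IH).
have [x xP] : exists x : 'I_n -> R -> R, forall i t k,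
    `|x i t - iterate k i t| <= 2 * (C * w t) / 2 ^+ k.
  suff /choice[x xP] : forall it, exists y, forall k,
      `|y - iterate k it.1 it.2| <= 2 * (C * w it.2) / 2 ^+ k.
    by exists (fun i t => x (i, t)) => i t; exact: (xP (i, t)).
  move=> [i t]; apply: geometric_sequence_limit => [|k] /=.
    by rewrite mulr_ge0// (le_trans _ (w1 i t)).
  by rewrite mulrAC iterateB.
have wb (i : 'I_n) t s : s < t -> w s <= w t.
  move=> st; rewrite /w ler_expR ler_wpM2l ?(L0 i)// lerB//.
  by rewrite ge_max !le_max (ltW st) lexx orbT.
(* The weight is nondecreasing, so the iterates converge uniformly to the left of [t + 1] and
   continuity passes to the limit. *)
have xc i : continuous (x i).
  move=> t; apply/cvgrPdist_lt => e e0.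
  have [k ke] :=
    lt_geometric_half (2 * (C * w (t + 1))) (e / 3) (divr_gt0 e0 (ltr0n R 3)).
  have bnd s : s < t + 1 -> `|x i s - iterate k i s| < e / 3.
    move=> st; apply: le_lt_trans (xP i s k) _; apply: le_lt_trans _ ke.
    by rewrite ler_wpM2r ?invr_ge0 ?exprn_ge0// ler_wpM2l// ler_wpM2l ?wb.
  near=> s.
  have /bnd bs : s < t + 1 by near: s; apply: lt_nbhsl; rewrite ltrDl.
  have /bnd bt : t < t + 1 by rewrite ltrDl.
  have : `|iterate k i t - iterate k i s| < e / 3.
    near: s; have /cvgrPdist_lt := iterate_continuous k i t.
    by apply; rewrite divr_gt0.
  exact: ltr_dist_thirds bt bs.
(* Both sides are within [C w t / 2 ^ k] of iterate [k + 1], one by the limit estimate and the other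
   by contraction; no limit is taken under the integral. *)
have xE i t : x i t = step x i t.
  apply/eqP; rewrite -subr_eq0 -normr_le0 leNgt; apply/negP => xs.
  have [k] := lt_geometric_half (2 * (C * w t)) _ xs.
  apply/negP; rewrite -leNgt.
  have := xP i t k.+1.
  have xit j s : `|x j s - iterate k j s| <= 2 * C / 2 ^+ k * w s.
    by apply: le_trans (xP j s k) _; rewrite mulrA mulrAC.
  have Ck : 0 <= 2 * C / 2 ^+ k by rewrite divr_ge0 ?mulr_ge0 ?exprn_ge0.
  have := step_bound x (iterate k) _ Ck xc (iterate_continuous k) xit i t.
  rewrite -/(iterate k.+1) exprS.
  rewrite (_ : 2 * (C * w t) / (2 * 2 ^+ k) = C * w t / 2 ^+ k); last first.
    by field; rewrite expf_neq0.
  rewrite (_ : 2 * C / 2 ^+ k / 2 * w t = C * w t / 2 ^+ k); last first.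
    by field; rewrite expf_neq0.
  rewrite (_ : 2 * (C * w t) / 2 ^+ k = C * w t / 2 ^+ k + C * w t / 2 ^+ k); last first.
    by rewrite -mulrDl; congr (_ / _); ring.
  rewrite distrC => h1 h2.
  rewrite -(subrKA (iterate k.+1 i t)) (le_trans (ler_normD _ _))// lerD//.
exists x; split => // [i|i t t0t]; first by rewrite xE step_t0.
by rewrite (funext (xE i)); exact: step_derive.
Unshelve. all: by end_near. Qed.

End LinearODE.

(** * Entrywise calculus and norm bounds for matrix-valued functions *)

Section MatrixCalculus.
Context {R : realType}.

Lemma is_derive_mxP (p q : nat) (F : R -> 'M[R]_(p, q)) t (dF : 'M[R]_(p, q)) :
  is_derive t (1 : R) F dF <->
  forall i j, is_derive t (1 : R) (fun s => F s i j) (dF i j).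
Proof.
split=> [[dFt <-] i j|dFij].
  by rewrite (derive_mx dFt) mxE; apply/derivableP; exact: (derivable_mxP F t 1).1.
have dFt : derivable F t 1.
  by apply/derivable_mxP => i j; exact: @ex_derive _ _ _ _ _ _ _ (dFij i j).
apply: (DeriveDef dFt _); rewrite (derive_mx dFt); apply/matrixP => i j.
by rewrite mxE; exact: @derive_val _ _ _ _ _ _ _ (dFij i j).
Qed.

Lemma is_derive_trmx (p q : nat) (F : R -> 'M[R]_(p, q)) t dF :
  is_derive t (1 : R) F dF -> is_derive t (1 : R) (fun s => (F s)^T) dF^T.
Proof.
move=> /is_derive_mxP dFF; apply/is_derive_mxP => i j; rewrite mxE.
under eq_fun do rewrite mxE.
exact: dFF.
Qed.

Lemma is_derive_mulmx (p q r : nat) (F : R -> 'M[R]_(p, q))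
    (G : R -> 'M[R]_(q, r)) t dF dG :
  is_derive t (1 : R) F dF -> is_derive t (1 : R) G dG ->
  is_derive t (1 : R) (fun s => F s *m G s) (dF *m G t + F t *m dG).
Proof.
move=> /is_derive_mxP dFF /is_derive_mxP dGG; apply/is_derive_mxP => i j.
under eq_fun do rewrite mxE.
rewrite !mxE -big_split/=; apply: is_derive_sumf => l.
exact: is_derive_mulf.
Qed.

Lemma is_derive_cst_mx (p q : nat) (M : 'M[R]_(p, q)) t :
  is_derive t (1 : R) (fun=> M) 0.
Proof. exact: is_derive_cst. Qed.

Lemma cvg_mxP (T : Type) (F : set_system T) (FF : Filter F) (p q : nat)
    (f : T -> 'M[R]_(p, q)) (M : 'M[R]_(p, q)) :
  (f x @[x --> F] --> M) <-> forall i j, f x i j @[x --> F] --> M i j.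
Proof.
split=> [fM i j|fM].
  apply/cvgrPdist_le => e e0; move/cvgrPdist_le : fM => /(_ e e0).
  apply: filterS => x; apply: le_trans.
  rewrite [leRHS]/Num.Def.normr/= mx_normrE.
  by apply: le_trans (le_bigmax _ _ (i, j)); rewrite !mxE.
apply/cvgrPdist_le => e e0; near=> x.
rewrite /Num.Def.normr/= mx_normrE (bigmax_le _ (ltW e0))//= => i _.
rewrite !mxE; move: i; near: x; apply: filter_forall => i.
exact: ((cvgrPdist_le _ _).1 (fM i.1 i.2)).
Unshelve. all: by end_near. Qed.

Lemma continuous_mxP (T : topologicalType) (p q : nat) (f : T -> 'M[R]_(p, q)) :
  continuous f <-> forall i j, continuous (fun x => f x i j).
Proof.
split=> [fc i j x|fc x]; first by move/cvg_mxP : (fc x); exact.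
by apply/cvg_mxP => i j; exact: fc.
Qed.

Lemma continuous_trmx (T : topologicalType) (p q : nat) (f : T -> 'M[R]_(p, q)) :
  continuous f -> continuous (fun x => (f x)^T).
Proof.
move=> /continuous_mxP fc; apply/continuous_mxP => i j.
by under eq_fun do rewrite mxE; exact: fc.
Qed.

Lemma continuous_mulmx (T : topologicalType) (p q r : nat)
    (f : T -> 'M[R]_(p, q)) (g : T -> 'M[R]_(q, r)) :
  continuous f -> continuous g -> continuous (fun x => f x *m g x).
Proof.
move=> /continuous_mxP fc /continuous_mxP gc; apply/continuous_mxP => i j.
under eq_fun do rewrite mxE.
by apply: continuous_sumf => l x; apply: cvgM; [exact: fc|exact: gc].
Qed.

Lemma mx_entry_norm (p q : nat) (M : 'M[R]_(p, q)) i j : `|M i j| <= `|M|.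
Proof.
rewrite [leRHS]/Num.Def.normr/= mx_normrE.
exact: le_trans (le_bigmax _ _ (i, j)).
Qed.

Lemma mx_norm_le (p q : nat) (M : 'M[R]_(p, q)) c : 0 <= c ->
  (forall i j, `|M i j| <= c) -> `|M| <= c.
Proof.
by move=> c0 Mc; rewrite [leLHS]/Num.Def.normr/= mx_normrE (bigmax_le _ c0).
Qed.

(** The norm is the largest entry, which is not submultiplicative, hence the factor [q]. *)
Lemma mulmx_norm_le (p q r : nat) (M : 'M[R]_(p, q)) (N : 'M[R]_(q, r)) :
  `|M *m N| <= q%:R * (`|M| * `|N|).
Proof.
apply: mx_norm_le => [|i j]; first by rewrite !mulr_ge0.
rewrite mxE (le_trans (ler_norm_sum _ _ _))//.
rewrite (le_trans (ler_sum _ (G := fun _ => `|M| * `|N|) _))//.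
  by move=> l _; rewrite normrM ler_pM// mx_entry_norm.
by rewrite sumr_const card_ord mulr_natl.
Qed.

End MatrixCalculus.

Section FundamentalMatrix.
Context {R : realType} {m : nat}.
Implicit Types (A X P : R -> 'M[R]_m).

Lemma fundamental_matrix A K t0 : continuous A -> (forall t, `|A t| <= K) ->
  exists X, [/\ continuous X, X t0 = 1%:M &
    forall t, t0 < t -> is_derive t (1 : R) X (A t *m X t)].
Proof.
move=> /continuous_mxP Ac AK.
have AijK t i j : `|A t i j| <= K by apply: le_trans (AK t); exact: mx_entry_norm.
have /choice[x xP] := fun j : 'I_m =>
  linear_ode_solution m A K t0 (fun i => (i == j)%:R) Ac AijK.
exists (fun t => \matrix_(i, j) x j i t); split.
- apply/continuous_mxP => i j; under eq_fun do rewrite mxE.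
  by have [+ _ _] := xP j; exact.
- by apply/matrixP => i j; rewrite !mxE; have [_ -> _] := xP j.
- move=> t t0t; apply/is_derive_mxP => i j; under eq_fun do rewrite mxE.
  rewrite mxE (eq_bigr (fun l => A t i l * x j l t)).
    by have [_ _] := xP j; exact.
  by move=> l _; rewrite mxE.
Qed.

Lemma mx_derive0_cst (p q : nat) (F : R -> 'M[R]_(p, q)) (a b : R) : a <= b ->
  continuous F -> (forall t, a < t -> t < b -> is_derive t (1 : R) F 0) ->
  F b = F a.
Proof.
move=> ab /continuous_mxP Fc dF; apply/matrixP => i j.
apply: (derive_eq0_cst (fun t => F t i j) _ _ ab).
  exact: continuous_subspaceT.
by move=> t at_ tb; have /is_derive_mxP/(_ i j) := dF t at_ tb; rewrite mxE.
Qed.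

(* The adjoint system [P' = - A^T P] has [P^T = X^-1] as its fundamental
   matrix, which yields the inverse of [X] without any determinant formula. *)
Lemma adjoint_fundamental_inverse A X P t0 :
  continuous X -> continuous P -> X t0 = 1%:M -> P t0 = 1%:M ->
  (forall t, t0 < t -> is_derive t (1 : R) X (A t *m X t)) ->
  (forall t, t0 < t -> is_derive t (1 : R) P (- (A t)^T *m P t)) ->
  forall t, t0 <= t -> (P t)^T *m X t = 1%:M.
Proof.
move=> Xc Pc X0 P0 dX dP t t0t.
have <- : (P t0)^T *m X t0 = 1%:M by rewrite X0 P0 trmx1 mul1mx.
apply: (mx_derive0_cst _ _ (fun s => (P s)^T *m X s) _ _ t0t).
- by apply: continuous_mulmx => //; exact: continuous_trmx.
- move=> s t0s _.
  have := is_derive_mulmx _ _ _ _ _ _ _ _ (is_derive_trmx _ _ _ _ _ (dP s t0s))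
    (dX s t0s).
  by rewrite trmx_mul linearN/= trmxK mulmxN mulNmx mulmxA addNr.
Qed.

End FundamentalMatrix.

(** * Periodic rates and sliding modes *)

Section Periodic.
Context {R : realType}.
Implicit Types (f : R -> R) (s t T : R).

Lemma periodic_int (V : zmodType) (f : R -> V) T : periodic f T ->
  forall (z : int) t, f (t + z%:~R * T) = f t.
Proof.
move=> fT; have fn (n : nat) t : f (t + n%:R * T) = f t.
  by rewrite mulr_natl periodicn.
case=> n t; first exact: fn.
by rewrite NegzE -(fn n.+1 (t + _)) -addrA mulrNz mulNr addNr addr0.
Qed.

Lemma periodic_representative T t : 0 < T ->
  exists2 z : int, 0 <= t + z%:~R * T & t + z%:~R * T < T.
Proof.
move=> T0; exists (- Num.floor (t / T)).
- by rewrite mulrNz mulNr subr_ge0 -ler_pdivlMr// floor_le_tmp.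
- rewrite mulrNz mulNr ltrBlDr -[X in X + _]mul1r -mulrDl -ltr_pdivrMr//.
  by rewrite addrC -[X in _ + X]/(1%:~R) -intrD floorD1_gt.
Qed.

Lemma continuous_periodic_bounded f T : 0 < T -> continuous f -> periodic f T ->
  exists K, forall t, `|f t| <= K.
Proof.
move=> T0 fc fT.
have [K _ fK] := within_continuous_bounded f 0 T (continuous_subspaceT fc).
exists K => t; have [z z0 zT] := periodic_representative T t T0.
by rewrite -(periodic_int _ f T fT z) fK// ltW.
Qed.

End Periodic.

Section StrictPrimitive.
Context {R : realType}.
Implicit Types (f F : R -> R) (s t T : R).

Lemma derive_within_continuous F f a b : (forall t, is_derive t (1 : R) F (f t)) ->
  {within `[a, b], continuous F}.
Proof.
move=> dF; apply: continuous_subspaceT => t.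
exact: is_derive_continuous _ _ _ (dF t).
Qed.

Lemma primitive_ge0_le F f s t : (forall t, is_derive t (1 : R) F (f t)) ->
  (forall t, 0 <= f t) -> s <= t -> F s <= F t.
Proof.
move=> dF f0 st.
exact: (ge0_derive_le F f _ _ st (derive_within_continuous _ _ _ _ dF)
  (fun u _ _ => dF u) (fun u _ _ => f0 u)).
Qed.

(** If [F s = F t], monotonicity makes [F] constant in between and its derivative at [u]
    vanishes. *)
Lemma primitive_strict_lt F f s t : (forall t, is_derive t (1 : R) F (f t)) ->
  (forall t, 0 <= f t) -> (exists u, [/\ s < u, u < t & f u != 0]) -> F s < F t.
Proof.
move=> dF f0 [u [su ut fu]]; rewrite lt_neqAle; apply/andP; split; last first.
  by apply: primitive_ge0_le dF f0 _; exact: ltW (lt_trans su ut).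
apply/eqP => Fst; move/negP : fu; apply; apply/eqP.
have FE v : s < v -> v < t -> F v = F s.
  move=> sv vt; apply/eqP; rewrite eq_le {1}Fst.
  by rewrite !(primitive_ge0_le _ _ _ _ dF f0)// ltW.
have d0 : is_derive u (1 : R) (fun=> F s) (f u).
  apply: near_eq_is_derive (dF u); near=> v.
  by apply: FE; near: v; [exact: lt_nbhsr|exact: lt_nbhsl].
have := @derive_val _ _ _ _ _ _ _ d0.
by rewrite (@derive_val _ _ _ _ _ _ _ (is_derive_cstf u (F s))).
Unshelve. all: by end_near. Qed.

Lemma Rintegral_primitive F f a b : a < b -> continuous f ->
  (forall t, is_derive t (1 : R) F (f t)) ->
  (\int[lebesgue_measure]_(t in `[a, b]) f t = F b - F a)%R.
Proof.
move=> ab fc dF.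
rewrite /Rintegral (@continuous_FTC2 R f F a b ab) ?EFinB//.
- exact: continuous_subspaceT.
- split.
  + by move=> t _; exact: @ex_derive _ _ _ _ _ _ _ (dF t).
  + by apply: cvg_at_right_filter; exact: is_derive_continuous _ _ _ (dF a).
  + by apply: cvg_at_left_filter; exact: is_derive_continuous _ _ _ (dF b).
- by move=> t _; rewrite derive1E; exact: @derive_val _ _ _ _ _ _ _ (dF t).
Qed.

Lemma primitive_shift F f T t : (forall t, is_derive t (1 : R) F (f t)) ->
  is_derive t (1 : R) (fun s => F (s + T) - F s) (f (t + T) - f t).
Proof.
move=> dF.
exact: is_derive_subf _ _ _ _ _ (is_derive_shiftf _ _ _ _ (dF (t + T))) (dF t).
Qed.

Lemma primitive_periodic F f T : periodic f T ->
  (forall t, is_derive t (1 : R) F (f t)) ->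
  forall t, F (t + T) - F t = F T - F 0.
Proof.
move=> fT dF t; have <- : F (0 + T) = F T by rewrite add0r.
apply: (@is_derive_0_is_cst _ (fun s => F (s + T) - F s) t 0) => s.
by rewrite -[X in is_derive _ _ _ X](subrr (f s)) -{1}(fT s); exact: primitive_shift.
Qed.

(** The increment of [F] over one period is nondecreasing in its starting point, so each period adds
    at least as much as the first. *)
Lemma primitive_unbounded F f T t0 : 0 < T ->
  (forall t, is_derive t (1 : R) F (f t)) ->
  (forall t, f t <= f (t + T)) -> F t0 < F (t0 + T) ->
  forall M, exists2 t, t0 < t & M <= F t - F t0.
Proof.
move=> T0 dF fT Ft0 M.
have grow t : t0 <= t -> F (t0 + T) - F t0 <= F (t + T) - F t.
  move=> t0t; apply: (primitive_ge0_le (fun s => F (s + T) - F s)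
    (fun s => f (s + T) - f s)) t0t.
    by move=> s; exact: primitive_shift.
  by move=> s; rewrite subr_ge0.
pose d := F (t0 + T) - F t0.
have d0 : 0 < d by rewrite subr_gt0.
have iter k : k%:R * d <= F (t0 + k%:R * T) - F t0.
  elim: k => [|k IH]; first by rewrite !mul0r addr0 subrr.
  have kT : t0 <= t0 + k%:R * T by rewrite lerDl mulr_ge0// ltW.
  have := grow _ kT; rewrite -/d -addrA => g.
  rewrite -[k.+1]addn1 natrD !mulrDl !mul1r; lra.
(* The successor keeps this time strictly after [t0] even when the bound is zero. *)
exists (t0 + (Num.bound (M / d)).+1%:R * T); first by rewrite ltrDl mulr_gt0.
apply: le_trans (iter _); rewrite -ler_pdivrMr//.
have [M0|M0] := leP 0 (M / d); last by rewrite ltW// (lt_le_trans M0).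
by rewrite ltW// (lt_trans (archi_boundP M0))// ltr_nat.
Qed.

End StrictPrimitive.

(** * Finite-time reaching for the scalar equation with a set-valued sign *)

Section SlidingMode.
Context {R : realType}.
Implicit Types (r G gam : R -> R) (s t v : R).

Lemma filippov_sign_mul s v : filippov_sign s v -> s * v = `|s|.
Proof.
rewrite /filippov_sign; case: ifPn => [s0 -> |s0]; first by rewrite mulr1 gtr0_norm.
case: ifPn => [s0' -> |s0' _]; first by rewrite mulrN1 ltr0_norm.
have -> : s = 0 by apply/eqP; rewrite eq_le !leNgt s0 s0'.
by rewrite mul0r normr0.
Qed.

Lemma filippov_sign_norm s v : filippov_sign s v -> `|v| <= 1.
Proof.
rewrite /filippov_sign; case: ifPn => [_ ->|_]; first by rewrite normr1.
case: ifPn => [_ ->|_]; first by rewrite normrN1.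
by rewrite /= in_itv/= ler_norml.
Qed.

Lemma filippov_sign_scale c s v : 0 < c ->
  filippov_sign (c * s) v = filippov_sign s v.
Proof. by move=> c0; rewrite /filippov_sign pmulr_rgt0// pmulr_rlt0. Qed.

Lemma filippov_signN s v : filippov_sign (- s) (- v) -> filippov_sign s v.
Proof.
rewrite /filippov_sign oppr_gt0 oppr_lt0.
have [s0|s0|s0] := ltgtP 0 s => /=.
- by move=> /oppr_inj.
- by move=> /(congr1 -%R); rewrite opprK.
- by rewrite !in_itv/= => /andP[? ?]; apply/andP; split; lra.
Qed.

Section Sliding.
Variables (G gam : R -> R) (t0 : R).
Hypothesis dG : forall t, is_derive t (1 : R) G (gam t).
Hypothesis gam0 : forall t, 0 <= gam t.
Hypothesis gamc : continuous gam.

Definition sliding r := (forall t, t0 < t -> abs_continuous t0 t r) /\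
  {ae lebesgue_measure, forall t, t0 < t ->
    exists2 v, filippov_sign (r t) v & is_derive t (1 : R) r (- gam t * v)}.

Lemma slidingN r : sliding r -> sliding (fun t => -1 * r t).
Proof.
move=> [rac dr]; split=> [t t0t|].
  by apply: abs_continuousM; [exact: abs_continuous_cst|exact: rac].
apply: ae_lebesgue_imply dr => t H t0t; have [v rv drt] := H t0t.
exists (- v); first by apply: filippov_signN; rewrite mulN1r !opprK.
rewrite (_ : - gam t * - v = 0 * r t + -1 * (- gam t * v)); last by ring.
exact: is_derive_mulf _ _ _ _ _ (is_derive_cstf t _) drt.
Qed.

(** The square replaces the absolute value, which need not be derivable at zeros of [r]; its
    derivative is [- 2 gam |r|]. *)
Lemma sliding_norm_nonincreasing r s t : sliding r -> t0 <= s -> s <= t ->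
  `|r t| <= `|r s|.
Proof.
move=> [rac dr] t0s st; have [->//|st'] := eqVneq s t.
have t0t : t0 < t by rewrite (le_lt_trans t0s)// lt_neqAle st'.
have sac : abs_continuous s t (r \* r).
  apply: (abs_continuous_sub _ _ t0 t) => //.
  by apply: abs_continuousM; exact: rac.
have : (r \* r) t - (r \* r) s <= 0 * (t - s).
  apply: ac_derive_le st sac _; apply: ae_lebesgue_imply dr => u H su ut.
  have [|v rv drt] := H; first exact: le_lt_trans su.
  exists (- gam u * v * r u + r u * (- gam u * v)).
    rewrite (_ : _ + _ = - (2 * gam u * (r u * v))); last by ring.
    by rewrite oppr_le0 (filippov_sign_mul _ _ rv) !mulr_ge0.
  exact: is_derive_mulf.
rewrite mul0r subr_le0 /= -!expr2 => rr.
by rewrite -ler_sqr ?nnegrE// !real_normK ?num_real.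
Qed.

(** A zero of [r] cannot be left again, so [r t > 0] makes [r] positive on all of [[t0, t]]. There
    the sign is 1 and [r + G] does not increase, which contradicts the bound on [r t0]. *)
Let reaching_pos r t : sliding r -> t0 < t -> `|r t0| <= G t - G t0 -> r t <= 0.
Proof.
move=> rs t0t rG; rewrite leNgt; apply/negP => rt0.
have [rac dr] := rs.
have rpos s : t0 <= s -> s <= t -> 0 < r s.
  move=> t0s st; rewrite ltNge; apply/negP => rs0.
  have rc : {within `[s, t], continuous r}.
    apply: abs_continuous_within; apply: (abs_continuous_sub _ _ t0 t) => //.
    exact: rac.
  have [|c + rc0] := IVT st rc (v := 0).
    by rewrite ge_min rs0/= le_max (ltW rt0) orbT.
  rewrite in_itv/= => /andP[sc ct].
  have := sliding_norm_nonincreasing r c t rs (le_trans t0s sc) ct.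
  by rewrite rc0 normr0 normr_le0 => /eqP rt; rewrite rt ltxx in rt0.
have Gac : abs_continuous t0 t G.
  have [K _ gamK] := within_continuous_bounded gam t0 t (continuous_subspaceT gamc).
  apply: (lipschitz_abs_continuous _ _ _ K).
  by apply: (derivative_bound_lipschitz G gam) => //; exact: derive_within_continuous.
have : (r \+ G) t - (r \+ G) t0 <= 0 * (t - t0).
  apply: ac_derive_le (ltW t0t) _ _.
    by apply: abs_continuousD => //; exact: rac.
  apply: ae_lebesgue_imply dr => u H t0u ut.
  have [v rv dru] := H t0u; exists (- gam u * v + gam u).
    have -> : v = 1 by move: rv; rewrite /filippov_sign rpos ?ltW.
    by rewrite mulr1 addNr.
  exact: is_derive_addf.
have := rpos t0 (lexx _) (ltW t0t) => r0; rewrite gtr0_norm// in rG.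
by rewrite mul0r /=; lra.
Qed.

Lemma sliding_reaching r t : sliding r -> t0 < t -> `|r t0| <= G t - G t0 ->
  r t = 0.
Proof.
move=> rs t0t rG; apply/eqP; rewrite eq_le (reaching_pos r t rs t0t rG)/=.
rewrite -oppr_le0 -mulN1r; apply: (reaching_pos _ t (slidingN r rs) t0t).
by rewrite mulN1r normrN.
Qed.

End Sliding.

End SlidingMode.

(** * The normal direction and the adjoint system *)

Section DotProduct.
Context {R : realType} {m : nat}.
Implicit Types (u v w : 'cV[R]_m).

Lemma dotvE u v : dotv u v = \sum_i u i 0 * v i 0.
Proof. by rewrite /dotv mxE; apply: eq_bigr => i _; rewrite mxE. Qed.

Lemma dotvC u v : dotv u v = dotv v u.
Proof. by rewrite !dotvE; apply: eq_bigr => i _; rewrite mulrC. Qed.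

Lemma dotvDr u v w : dotv u (v + w) = dotv u v + dotv u w.
Proof. by rewrite /dotv mulmxDr mxE. Qed.

Lemma dotvNr u v : dotv u (- v) = - dotv u v.
Proof. by rewrite /dotv mulmxN mxE. Qed.

Lemma dotvZr c u v : dotv u (c *: v) = c * dotv u v.
Proof. by rewrite /dotv -scalemxAr mxE. Qed.

Lemma dotvZl c u v : dotv (c *: u) v = c * dotv u v.
Proof. by rewrite dotvC dotvZr dotvC. Qed.

Lemma dotv0l v : dotv 0 v = 0.
Proof. by rewrite -(scale0r 0) dotvZl mul0r. Qed.

Lemma dotv_mulmxr (M : 'M[R]_m) u v : dotv u (M *m v) = dotv (M^T *m u) v.
Proof. by rewrite /dotv trmx_mul trmxK mulmxA. Qed.

Lemma dotv_eq0 u : dotv u u = 0 -> u = 0.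
Proof.
rewrite dotvE => /eqP; rewrite psumr_eq0 => [/allP u0|i _]; last first.
  by rewrite -expr2 sqr_ge0.
apply/matrixP => i j; rewrite ord1 mxE; apply/eqP.
by have := u0 i; rewrite mem_index_enum mulf_eq0 orbb => /(_ isT).
Qed.

Lemma unit_sphere_dotv u : unit_sphere u -> dotv u u = 1.
Proof.
rewrite /unit_sphere/= => /(congr1 (fun x => x ^+ 2)).
rewrite sqr_sqrtr ?expr1n; last by apply: sumr_ge0 => i _; exact: sqr_ge0.
by move=> <-; rewrite dotvE; apply: eq_bigr => i _; rewrite expr2.
Qed.

(** The component of [w] orthogonal to [u] is annihilated by both [w] and [u], hence orthogonal to
    itself. *)
Lemma unit_normal_unique u w : dotv u u = 1 ->
  (forall v, dotv u v = 0 -> dotv w v = 0) -> w = dotv u w *: u.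
Proof.
move=> u1 uw; pose v := w + - dotv u w *: u.
have uv : dotv u v = 0 by rewrite dotvDr dotvZr u1 mulr1 subrr.
have wv : dotv w v = 0 by exact: uw.
have : dotv v v = 0.
  by rewrite {2}/v dotvDr dotvZr (dotvC v w) wv (dotvC v u) uv mulr0 addr0.
by move/dotv_eq0/eqP; rewrite /v scaleNr subr_eq0 => /eqP.
Qed.

Lemma dotv_norm_le u v : `|dotv u v| <= m%:R * (`|u| * `|v|).
Proof.
rewrite dotvE (le_trans (ler_norm_sum _ _ _))//.
rewrite (le_trans (ler_sum _ (G := fun _ => `|u| * `|v|) _))//.
  by move=> l _; rewrite normrM ler_pM// mx_entry_norm.
by rewrite sumr_const card_ord mulr_natl.
Qed.

Lemma continuous_dotv (f g : R -> 'cV[R]_m) : continuous f -> continuous g ->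
  continuous (fun t => dotv (f t) (g t)).
Proof.
move=> fc gc; apply: (continuous_mxP _ _ _ _).1.
by apply: continuous_mulmx => //; exact: continuous_trmx.
Qed.

Lemma is_derive_dotv (f g : R -> 'cV[R]_m) t df dg :
  is_derive t (1 : R) f df -> is_derive t (1 : R) g dg ->
  is_derive t (1 : R) (fun s => dotv (f s) (g s)) (dotv df (g t) + dotv (f t) dg).
Proof.
move=> dff dgg.
have /is_derive_mxP := is_derive_mulmx _ _ _ _ _ _ _ _ (is_derive_trmx _ _ _ _ _ dff) dgg.
by move=> /(_ 0 0); rewrite mxE.
Qed.

End DotProduct.

Section AdjointNormal.
Context {R : realType} {m : nat}.
Variables (A : R -> 'M[R]_m) (n : R -> 'cV[R]_m) (X P : R -> 'M[R]_m) (t0 : R).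
Hypothesis n_unit : forall t, dotv (n t) (n t) = 1.
Hypothesis n_cont : continuous n.
Hypothesis S_inv : stable_invariant A (orth_plane n).
Hypothesis Xc : continuous X.
Hypothesis X0 : X t0 = 1%:M.
Hypothesis dX : forall t, t0 < t -> is_derive t (1 : R) X (A t *m X t).
Hypothesis Pc : continuous P.
Hypothesis P0 : P t0 = 1%:M.
Hypothesis dP : forall t, t0 < t -> is_derive t (1 : R) P (- (A t)^T *m P t).

Lemma adjoint_inverse t : t0 <= t -> (P t)^T *m X t = 1%:M.
Proof. exact: (adjoint_fundamental_inverse A X P t0 Xc Pc X0 P0 dX dP). Qed.

Lemma fundamental_solution t1 y : t0 <= t1 ->
  linear_solution A t1 (fun t => X t *m y).
Proof.
move=> t01; split.
  apply: continuous_subspaceT; apply: continuous_mulmx => // t.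
  exact: cvg_cst.
move=> t t1t; have t0t := le_lt_trans t01 t1t.
have := is_derive_mulmx _ _ _ _ _ _ _ _ (dX t t0t) (is_derive_cst_mx _ _ y t).
by rewrite mulmx0 addr0 mulmxA.
Qed.

(** By invariance [X t] maps the plane at [t0] into the plane at [t], so [(X t)^T n t] annihilates
    the former and is a multiple of [n t0]. Applying [P t], the inverse of [(X t)^T], gives the
    claim; the factor is invertible because [n t] is a unit vector. *)
Lemma adjoint_normal t : t0 <= t ->
  P t *m n t0 = dotv (n t) (P t *m n t0) *: n t.
Proof.
move=> t0t.
have XnP : (X t)^T *m n t = dotv (n t0) ((X t)^T *m n t) *: n t0.
  apply: unit_normal_unique => // v nv.
  rewrite -dotv_mulmxr.
  have St0 : orth_plane n t0 (X t0 *m v) by rewrite X0 mul1mx.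
  have [SX _] := S_inv t0 _ (fundamental_solution t0 v (lexx _)) St0.
  exact: SX.
set g := dotv (n t0) _ in XnP.
have PX : P t *m (X t)^T = 1%:M.
  by rewrite -[P t]trmxK -trmx_mul (mulmx1C (adjoint_inverse t t0t)) trmx1.
have nE : n t = g *: (P t *m n t0).
  by rewrite scalemxAr -XnP mulmxA PX mul1mx.
have g1 : g * dotv (n t) (P t *m n t0) = 1.
  by rewrite -dotvZr -nE.
by rewrite {2}nE scalerA mulrC g1 scale1r.
Qed.

Variable alpha : R -> R.
Hypothesis dalpha :
  forall t, is_derive t (1 : R) alpha (dotv (n t) (A t *m n t)).

Let coef t := dotv (n t) (P t *m n t0).

Let p_cont : continuous (fun t => P t *m n t0).
Proof. by apply: continuous_mulmx => // ?; exact: cvg_cst. Qed.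

Let coef_cont : continuous coef.
Proof. exact: continuous_dotv. Qed.

(** The coefficient contains [n] and need not be derivable, but its square is the squared length of
    [P t *m n t0], which solves a scalar linear equation with rate [- 2 n^T A n]. *)
Let coef_sqr t : t0 <= t -> coef t ^+ 2 = expR (- (alpha t - alpha t0)) ^+ 2.
Proof.
move=> t0t; pose E s := expR (alpha s - alpha t0).
pose N s := dotv (P s *m n t0) (P s *m n t0).
have dE s : is_derive s (1 : R) E (dotv (n s) (A s *m n s) * E s).
  have := is_derive_expf _ _ _ (is_derive_subf _ _ _ _ _ (dalpha s)
    (is_derive_cstf s (alpha t0))).
  by rewrite subr0.
have NE s : t0 <= s -> N s = coef s ^+ 2.
  by move=> t0s; rewrite /N adjoint_normal// dotvZl dotvZr n_unit mulr1 expr2.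
have Ec : continuous E by move=> s; exact: is_derive_continuous _ _ _ (dE s).
have : N t * (E t * E t) = N t0 * (E t0 * E t0).
  apply: (derive_eq0_cst (fun s => N s * (E s * E s)) _ _ t0t).
    apply: continuous_subspaceT => s.
    by apply: cvgM; [exact: continuous_dotv|apply: cvgM; exact: Ec].
  move=> s t0s _.
  have dp := is_derive_mulmx _ _ _ _ _ _ _ _ (dP s t0s) (is_derive_cst_mx _ _ (n t0) s).
  have := is_derive_mulf _ _ _ _ _ (is_derive_dotv _ _ _ _ _ dp dp)
    (is_derive_mulf _ _ _ _ _ (dE s) (dE s)).
  have pA : dotv (P s *m n t0) ((A s)^T *m (P s *m n t0)) =
      coef s ^+ 2 * dotv (n s) (A s *m n s).
    rewrite dotv_mulmxr trmxK (adjoint_normal s (ltW t0s)) -/(coef s).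
    by rewrite -scalemxAr dotvZl dotvZr dotvC mulrA expr2.
  rewrite mulmx0 addr0 -mulmxA mulNmx (dotvC (- _)) dotvNr pA.
  rewrite -/(N s) NE ?ltW// (_ : _ + _ = 0)//; ring.
rewrite NE// /N P0 mul1mx n_unit /E subrr expR0 !mulr1 => cE.
rewrite expRN; set e := expR _ in cE *.
have e0 : e != 0 by rewrite gt_eqF ?expR_gt0.
apply: (mulIf (mulf_neq0 e0 e0)); rewrite cE.
by field.
Qed.

(** The square leaves the sign open. The coefficient is continuous, equals 1 at [t0] and never
    vanishes, so it stays positive. *)
Lemma adjoint_normal_coef t : t0 <= t ->
  dotv (n t) (P t *m n t0) = expR (- (alpha t - alpha t0)).
Proof.
move=> t0t; rewrite -/(coef t).
have : 0 <= coef t.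
  rewrite leNgt; apply/negP => ct.
  have c0 : coef t0 = 1 by rewrite /coef P0 mul1mx n_unit.
  have [|s + cs] := IVT t0t (continuous_subspaceT coef_cont) (v := 0).
    by rewrite c0 ge_min (ltW ct) orbT le_max ler01.
  rewrite in_itv/= => /andP[t0s _]; have := coef_sqr s t0s.
  rewrite cs expr0n/= => /esym/eqP.
  by rewrite expf_eq0/= gt_eqF ?expR_gt0.
move=> c0; apply/eqP; rewrite -(@eqrXn2 _ 2)// ?expR_ge0//.
by rewrite coef_sqr.
Qed.

End AdjointNormal.

(** * The closed loop *)

Section System.
Context {R : realType} {m : nat}.
Variables (T : R) (A : R -> 'M[R]_m.+1) (B n : R -> 'cV[R]_m.+1) (b : R -> R).
Variables (eps k1 k2 : R).
Hypothesis T_gt0 : 0 < T.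
Hypothesis A_cont : continuous A.
Hypothesis B_cont : continuous B.
Hypothesis A_per : periodic A T.
Hypothesis B_per : periodic B T.
Hypothesis n_cont : continuous n.
Hypothesis n_unit : forall t, dotv (n t) (n t) = 1.
Hypothesis S_per : forall t, orth_plane n (t + T) = orth_plane n t.
Hypothesis S_inv : stable_invariant A (orth_plane n).
Hypothesis b_def : forall t, b t = dotv (n t) (B t).
Hypothesis b_simple : forall t, t \in `[0, T] -> b t = 0 ->
  derivable b t 1 /\ derive1 b t != 0.
Hypothesis eps_gt0 : 0 < eps.
Hypothesis k1_gt0 : 0 < k1.

Let gain t := b t * sigma eps (b t).
Let growth t := dotv (n t) (A t *m n t).

(** Equal planes have equal normals only up to the sign [l], so [b] itself may change sign after a
    period. *)
Lemma normal_shift t : exists2 l, l * l = 1 & n (t + T) = l *: n t.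
Proof.
have nE : n (t + T) = dotv (n t) (n (t + T)) *: n t.
  apply: unit_normal_unique => // v nv.
  have : orth_plane n t v by [].
  by rewrite -S_per.
exists (dotv (n t) (n (t + T))) => //; set l := dotv _ _ in nE *.
by rewrite -(n_unit (t + T)) nE dotvZl dotvZr n_unit mulr1.
Qed.

Lemma gainE t : gain t = b t ^+ 2 / (`|b t| + eps).
Proof. by rewrite /gain /sigma mulrA expr2. Qed.

Let den_gt0 t : 0 < `|b t| + eps.
Proof. by rewrite ltr_wpDl. Qed.

Lemma gain_ge0 t : 0 <= gain t.
Proof. by rewrite gainE divr_ge0 ?sqr_ge0// ltW. Qed.

Lemma gain_eq0 t : gain t = 0 -> b t = 0.
Proof.
move/eqP; rewrite gainE mulf_eq0 invr_eq0 (gt_eqF (den_gt0 t)) orbF.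
by rewrite expf_eq0/= => /eqP.
Qed.

Lemma b_cont : continuous b.
Proof. by rewrite (funext b_def); exact: continuous_dotv. Qed.

Lemma gain_cont : continuous gain.
Proof.
move=> t; apply: cvgM; first exact: b_cont.
apply: cvgM; first exact: b_cont.
apply: cvgV; first by rewrite gt_eqF.
by apply: cvgD; [apply: cvg_norm; exact: b_cont|exact: cvg_cst].
Qed.

Lemma growth_cont : continuous growth.
Proof. by apply: continuous_dotv => //; exact: continuous_mulmx. Qed.

Lemma sqr_b_periodic : periodic (fun t => b t ^+ 2) T.
Proof.
move=> t; have [l l1 nl] := normal_shift t.
by rewrite !b_def nl B_per dotvZl exprMn expr2 l1 mul1r.
Qed.

Lemma gain_periodic : periodic gain T.
Proof.
move=> t; have := sqr_b_periodic t; rewrite !gainE => bT.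
by rewrite bT -(sqrtr_sqr (b (t + T))) bT sqrtr_sqr.
Qed.

Lemma growth_periodic : periodic growth T.
Proof.
move=> t; have [l l1 nl] := normal_shift t.
by rewrite /growth nl A_per -scalemxAr dotvZl dotvZr mulrA l1 mul1r.
Qed.

(** Otherwise [b] would vanish on an interval. Shifted by a multiple of [T], the interval surrounds
    a point of [[0, T]] at which [b] has a zero with zero derivative, against simplicity. *)
Lemma gain_nonzero s t : s < t -> exists u, [/\ s < u, u < t & gain u != 0].
Proof.
move=> st; apply: contrapT => /forallNP g0.
have bz u : s < u -> u < t -> b u = 0.
  move=> su ut; apply: gain_eq0; apply/eqP; apply: contrapT => /negP gu.
  by apply: (g0 u).
pose c := (s + t) / 2.
have sc : s < c by rewrite /c; lra.
have ct : c < t by rewrite /c; lra.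
have [z z0 zT] := periodic_representative T c T_gt0.
pose d := c + z%:~R * T.
have bd : \forall u \near d, b u = 0.
  near=> u; apply/eqP; rewrite -sqrf_eq0 -(subrK (z%:~R * T) u).
  rewrite (periodic_int _ _ _ sqr_b_periodic) bz ?expr0n//.
  - by rewrite ltrBrDr; near: u; apply: lt_nbhsr; rewrite /d ltrD2r.
  - by rewrite ltrBlDr; near: u; apply: lt_nbhsl; rewrite /d ltrD2r.
have [||_ /eqP] := b_simple d.
- by rewrite in_itv/= z0 ltW.
- exact: nbhs_singleton bd.
- apply; rewrite derive1E.
  by rewrite (@near_eq_derive _ _ _ b (fun=> 0) d 1 bd) derive_cst.
Unshelve. all: by end_near. Qed.

Variables (g alpha : R -> R).
Hypothesis dg : forall t, is_derive t (1 : R) g (gain t).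
Hypothesis dalpha : forall t, is_derive t (1 : R) alpha (growth t).
Hypothesis k2_gt : (alpha T - alpha 0) / (g T - g 0) < k2.

Lemma g_strict s t : s < t -> g s < g t.
Proof.
by move=> st; apply: primitive_strict_lt dg gain_ge0 _; exact: gain_nonzero.
Qed.

Let H t := k2 * g t - alpha t.

Let dH t : is_derive t (1 : R) H (k2 * gain t - growth t).
Proof.
have := is_derive_subf _ _ _ _ _
  (is_derive_mulf _ _ _ _ _ (is_derive_cstf t k2) (dg t)) (dalpha t).
by rewrite mul0r add0r.
Qed.

Let H_shift t : H (t + T) - H t = H T - H 0.
Proof.
apply: (primitive_periodic H (fun t => k2 * gain t - growth t)) => // s.
by rewrite gain_periodic growth_periodic.
Qed.

(** This is the condition on [k2], cleared of its denominator, which is positive because [g] is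
    strictly increasing. *)
Let H_growth : 0 < H T - H 0.
Proof.
have := k2_gt; rewrite ltr_pdivrMr ?subr_gt0 ?g_strict//.
rewrite /H; lra.
Qed.

Variable t0 : R.

Let h t := expR (H t - H t0).
Let gam t := k1 * (gain t * h t).

Let h_gt0 t : 0 < h t. Proof. exact: expR_gt0. Qed.

Let h_cont : continuous h.
Proof.
move=> t.
exact: is_derive_continuous _ _ _ (is_derive_expf _ _ _
  (is_derive_subf _ _ _ _ _ (dH t) (is_derive_cstf t (H t0)))).
Qed.

Lemma sliding_rate_cont : continuous gam.
Proof.
move=> t; apply: cvgM; first exact: cvg_cst.
by apply: cvgM; [exact: gain_cont|exact: h_cont].
Qed.

Let gam_ge0 t : 0 <= gam t.
Proof.
apply: mulr_ge0; first exact: ltW.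
by apply: mulr_ge0; [exact: gain_ge0|exact: expR_ge0].
Qed.

Variable G : R -> R.
Hypothesis dG : forall t, is_derive t (1 : R) G (gam t).

Lemma G_strict s t : s < t -> G s < G t.
Proof.
move=> st; apply: primitive_strict_lt dG gam_ge0 _.
have [u [su ut gu]] := gain_nonzero s t st; exists u; split => //.
apply: mulf_neq0; first by rewrite gt_eqF.
by apply: mulf_neq0 => //; rewrite gt_eqF.
Qed.

Lemma G_unbounded M : exists2 t, t0 < t & M <= G t - G t0.
Proof.
apply: (primitive_unbounded G gam T t0 T_gt0 dG) => [t|]; last first.
  by apply: G_strict; rewrite ltrDl.
rewrite /gam gain_periodic ler_pM2l// ler_wpM2l ?gain_ge0// ler_expR lerD2r.
by rewrite -subr_ge0 H_shift ltW.
Qed.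


Variables (X P : R -> 'M[R]_m.+1).
Hypothesis Xc : continuous X.
Hypothesis X0 : X t0 = 1%:M.
Hypothesis dX : forall t, t0 < t -> is_derive t (1 : R) X (A t *m X t).
Hypothesis Pc : continuous P.
Hypothesis P0 : P t0 = 1%:M.
Hypothesis dP : forall t, t0 < t -> is_derive t (1 : R) P (- (A t)^T *m P t).

Let F := closed_loop A B (feedback B n eps k1 k2).

Let adjoint_n t : t0 <= t ->
  P t *m n t0 = expR (- (alpha t - alpha t0)) *: n t.
Proof.
move=> t0t.
rewrite (adjoint_normal A n X P t0 n_unit S_inv Xc X0 dX Pc P0 dP t t0t).
by rewrite (adjoint_normal_coef A n X P t0 n_unit n_cont S_inv Xc X0 dX Pc P0 dP
  alpha dalpha t t0t).
Qed.

(** Bounds the speed of [(P t)^T *m x t] for all solutions with [|x t0| <= 1] at once. The middle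
    factor bounds the control: [|sigma| <= 1], and [|s| = |r| / h] with [|r| <= |r t0|]. *)
Definition velocity_bound t := m.+1%:R * (`|(P t)^T| *
  ((k1 + `|k2| * (m.+1%:R * `|n t0| * expR (- (H t - H t0)))) * `|B t|)).

Section Solution.
Variable x : R -> 'cV[R]_m.+1.
Hypothesis Fx : inclusion_solution F t0 x.

Let s t := dotv (n t) (x t).
Let y t := (P t)^T *m x t.
Let e t := expR (k2 * (g t - g t0)).
Let r t := e t * dotv (n t0) (y t).

Let eE t : h t = e t * expR (- (alpha t - alpha t0)).
Proof. by rewrite /h /e -expRD /H; congr expR; ring. Qed.

Let rE t : t0 <= t -> r t = h t * s t.
Proof.
move=> t0t; rewrite /r /y dotv_mulmxr trmxK adjoint_n// dotvZl mulrA.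
by rewrite -eE.
Qed.

Let xE t : t0 <= t -> x t = X t *m y t.
Proof.
move=> t0t; rewrite /y mulmxA mulmx1C ?mul1mx//.
exact: (adjoint_inverse A X P t0 Xc X0 dX Pc P0 dP).
Qed.

(** The control [u] and the selected sign [v] are exposed together, so that the equations for [y]
    and for [r] refer to the same selection. *)
Definition closed_loop_velocity t u v :=
  [/\ filippov_sign (s t) v, u = - sigma eps (b t) * (k1 * v + k2 * s t) &
      is_derive t (1 : R) x (A t *m x t + u *: B t)].

Lemma ae_closed_loop_velocity : {ae lebesgue_measure, forall t, t0 < t ->
  exists u v, closed_loop_velocity t u v}.
Proof.
apply: ae_lebesgue_imply Fx.2 => t Hx t0t; have [dx] := Hx t0t.
move=> [u [v sv uE] xE']; exists u, v; split => //.
- by rewrite -uE b_def.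
- by rewrite xE' derive1E; exact: derivableP.
Qed.

Let dy t u v : t0 < t -> closed_loop_velocity t u v ->
  is_derive t (1 : R) y ((P t)^T *m (u *: B t)).
Proof.
move=> t0t [_ _ dx].
have := is_derive_mulmx _ _ _ _ _ _ _ _ (is_derive_trmx _ _ _ _ _ (dP t t0t)) dx.
rewrite trmx_mul linearN/= trmxK mulmxDr mulmxN mulNmx -mulmxA.
by rewrite addrA addNr add0r.
Qed.

Let de t : is_derive t (1 : R) e (k2 * gain t * e t).
Proof.
have := is_derive_expf _ _ _ (is_derive_mulf _ _ _ _ _ (is_derive_cstf t k2)
  (is_derive_subf _ _ _ _ _ (dg t) (is_derive_cstf t (g t0)))).
by rewrite mul0r add0r subr0.
Qed.

(** The derivative of [e] contributes [k2 gain r], which cancels the [k2] part of the control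
    exactly. *)
Let dr t u v : t0 < t -> closed_loop_velocity t u v ->
  is_derive t (1 : R) r (- gam t * v).
Proof.
move=> t0t V; have [_ uE _] := V.
have := is_derive_mulf _ _ _ _ _ (de t)
  (is_derive_dotv _ _ _ _ _ (is_derive_cst_mx _ _ (n t0) t) (dy t u v t0t V)).
rewrite (_ : _ + _ = - gam t * v)//.
rewrite dotv0l add0r.
have -> : k2 * gain t * e t * dotv (n t0) (y t) = k2 * gain t * (h t * s t).
  by rewrite -mulrA -/(r t) rE// ltW.
rewrite [X in _ + X](_ : _ = h t * (b t * u)).
  by rewrite /gam uE /gain; ring.
rewrite dotv_mulmxr trmxK adjoint_n ?ltW// dotvZl dotvZr -b_def eE.
by ring.
Qed.

Let lipschitz_on_segment (f df : R -> R) t : continuous f -> continuous df ->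
  (forall t, t0 < t -> is_derive t (1 : R) f (df t)) -> abs_continuous t0 t f.
Proof.
move=> fc dfc dff.
have [K _ fK] := within_continuous_bounded df t0 t (continuous_subspaceT dfc).
apply: (lipschitz_abs_continuous _ _ _ K).
apply: (derivative_bound_lipschitz f df) => //; first exact: continuous_subspaceT.
by move=> u t0u _; exact: dff.
Qed.

Let y_ac t i : t0 < t -> abs_continuous t0 t (fun u => y u i 0).
Proof.
move=> t0t; have [xac _] := Fx.
under eq_fun do rewrite mxE.
apply: (abs_continuous_sum _ (fun j u => (P u)^T i j * x u j 0)) => j.
apply: abs_continuousM; last exact: abs_continuous_coord (xac t t0t).
under eq_fun do rewrite mxE.
apply: (lipschitz_on_segment (fun u => P u j i) (fun u => (- (A u)^T *m P u) j i)).
- exact: (continuous_mxP _ _ _ _).1.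
- apply: (continuous_mxP _ _ _ _).1; apply: continuous_mulmx => // u.
  by apply: cvgN; exact: continuous_trmx.
- by move=> u t0u; exact: ((is_derive_mxP _ _ _ _ _).1 (dP u t0u)).
Qed.

Let sliding_r : sliding gam t0 r.
Proof.
split=> [t t0t|].
  apply: abs_continuousM.
    apply: (lipschitz_on_segment e (fun u => k2 * gain u * e u)) => u.
    - exact: is_derive_continuous _ _ _ (de u).
    - apply: cvgM; last exact: is_derive_continuous _ _ _ (de u).
      by apply: cvgM; [exact: cvg_cst|exact: gain_cont].
    - by move=> _; exact: de.
  under eq_fun do rewrite dotvE.
  apply: (abs_continuous_sum _ (fun i u => n t0 i 0 * y u i 0)) => i.
  apply: abs_continuousM; last exact: y_ac.
  exact: abs_continuous_cst.
apply: ae_lebesgue_imply ae_closed_loop_velocity => t Hx t0t.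
have [u [v V]] := Hx t0t; exists v; last exact: dr V.
by rewrite rE ?ltW// filippov_sign_scale//; have [] := V.
Qed.

Lemma reached t1 t : t0 < t1 -> `|dotv (n t0) (x t0)| <= G t1 - G t0 ->
  t1 <= t -> dotv (n t) (x t) = 0.
Proof.
move=> t01 sG t1t; have t0t := lt_le_trans t01 t1t.
have r0 : r t0 = dotv (n t0) (x t0).
  by rewrite /r /e /y subrr mulr0 expR0 mul1r P0 trmx1 mul1mx.
have rt : r t = 0.
  apply: (sliding_reaching G gam t0 dG gam_ge0 sliding_rate_cont r t sliding_r t0t).
  rewrite r0 (le_trans sG)// lerD2r.
  exact: primitive_ge0_le dG gam_ge0 t1t.
apply/eqP; rewrite -[_ == 0](mulrI_eq0 _ (mulfI (lt0r_neq0 (h_gt0 t)))).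
by rewrite -/(s t) -rE ?ltW// rt.
Qed.

Lemma fundamental_adjoint t : t0 <= t -> x t = X t *m ((P t)^T *m x t).
Proof. exact: xE. Qed.

(* On the sliding surface the control vanishes almost everywhere: [r = 0]
   forces [b v = 0], and [sigma] vanishes with [b]. *)
Lemma sliding_mode t1 t : t0 < t1 ->
  (forall t, t1 <= t -> dotv (n t) (x t) = 0) ->
  t1 <= t -> (P t)^T *m x t = (P t1)^T *m x t1.
Proof.
move=> t01 s0 t1t; apply/matrixP => i j; rewrite (ord1 j).
apply/eqP; rewrite -subr_eq0 -normr_le0 -(mul0r (t - t1)).
have t0t := lt_le_trans t01 t1t.
apply: (ac_derive_norm_le (fun u => y u i 0) _ _ _ t1t).
  exact: (abs_continuous_sub _ _ t0 t t1 t (ltW t01) (lexx t) (y_ac t i t0t)).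
apply: ae_lebesgue_imply ae_closed_loop_velocity => u Hx t1u ut.
have t0u := lt_trans t01 t1u.
have [w [v V]] := Hx t0u; exists 0; first by rewrite normr0.
have r0 : - gam u * v = 0.
  have r0 : is_derive u (1 : R) (fun=> 0) (- gam u * v).
    apply: near_eq_is_derive (dr u w v t0u V); near=> z.
    have t1z : t1 < z by near: z; exact: lt_nbhsr.
    by rewrite rE ?(ltW (lt_trans t01 t1z))// /s s0 ?mulr0// ltW.
  rewrite -(@derive_val _ _ _ _ _ _ _ r0).
  by rewrite (@derive_val _ _ _ _ _ _ _ (is_derive_cstf u 0)).
have w0 : w = 0.
  have [_ -> _] := V; rewrite /s s0 ?ltW// mulr0 addr0.
  move/eqP : r0; rewrite mulNr oppr_eq0 mulf_eq0 => /orP[|/eqP ->]; last first.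
    by rewrite mulr0 mulr0.
  rewrite /gam mulf_eq0 (gt_eqF k1_gt0)/= mulf_eq0 (gt_eqF (h_gt0 u)) orbF.
  by move=> /eqP/gain_eq0 ->; rewrite /sigma !mul0r oppr0 mul0r.
have := (is_derive_mxP _ _ _ _ _).1 (dy u w v t0u V) i 0.
by rewrite w0 scale0r mulmx0 mxE.
Unshelve. all: by end_near. Qed.

Lemma sliding_exit t1 t : t0 < t1 -> `|dotv (n t0) (x t0)| <= G t1 - G t0 ->
  t1 <= t -> x t = X t *m ((P t1)^T *m x t1).
Proof.
move=> t01 sG t1t; rewrite xE ?(le_trans (ltW t01))//.
rewrite /y (sliding_mode t1)// => u; exact: reached.
Qed.

Lemma closed_loop_attractive : x t @[t --> +oo] --> (0 : 'cV[R]_m.+1).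
Proof.
have [t1 t01 sG] := G_unbounded `|dotv (n t0) (x t0)|.
pose z t := X t *m ((P t1)^T *m x t1).
have z1 : orth_plane n t1 (z t1).
  by rewrite /orth_plane/= /z -sliding_exit//; apply: reached sG _.
have [_ z0] := S_inv t1 z (fundamental_solution A X t0 Xc dX t1 _ (ltW t01)) z1.
apply: cvg_trans z0; apply: near_eq_cvg; near=> t.
have t1t : t1 <= t by near: t; apply: nbhs_pinfty_ge; exact: num_real.
exact/esym/(sliding_exit t1 t t01 sG t1t).
Unshelve. all: by end_near. Qed.

Let dotv_n0_le : `|dotv (n t0) (x t0)| <= m.+1%:R * `|n t0| * `|x t0|.
Proof. by rewrite -mulrA dotv_norm_le. Qed.

Lemma adjoint_state_drift t1 C : t0 < t1 -> `|x t0| <= 1 ->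
  (forall t, t0 <= t -> t <= t1 -> velocity_bound t <= C) ->
  forall t, t0 <= t -> t <= t1 ->
    `|(P t)^T *m x t| <= `|x t0| + C * (t - t0).
Proof.
move=> t01 x1 VC t t0t tt1.
have y0 : y t0 = x t0 by rewrite /y P0 trmx1 mul1mx.
have r0 : r t0 = dotv (n t0) (x t0).
  by rewrite /r /e y0 subrr mulr0 expR0 mul1r.
have C0 : 0 <= C.
  apply: le_trans (VC t0 (lexx _) (ltW t01)).
  by rewrite /velocity_bound mulr_ge0// mulr_ge0// mulr_ge0// addr_ge0 ?(ltW k1_gt0)//.
have yB i : `|y t i 0 - y t0 i 0| <= C * (t - t0).
  have [->|tt0] := eqVneq t t0; first by rewrite !subrr normr0 mulr0.
  have {}tt0 : t0 < t by rewrite lt_neqAle eq_sym tt0.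
  apply: (ac_derive_norm_le (fun u => y u i 0) _ _ _ t0t); first exact: y_ac.
  apply: ae_lebesgue_imply ae_closed_loop_velocity => u Hx t0u ut.
  have [w [v V]] := Hx t0u; exists (((P u)^T *m (w *: B u)) i 0); last first.
    exact: (is_derive_mxP _ _ _ _ _).1 (dy u w v t0u V) i 0.
  apply: le_trans (VC u (ltW t0u) _); last by rewrite ltW// (lt_le_trans ut).
  apply: le_trans (mx_entry_norm _ _ _ i 0) _.
  apply: le_trans (mulmx_norm_le _ _ _ _ _) _.
  rewrite /velocity_bound ler_wpM2l// ler_wpM2l// normrZ ler_wpM2r//.
  have [sv -> _] := V.
  (* Since [|r|] never grows, [s = r / h] is controlled by the initial state, whose norm is at most
     1. *)
  have su : `|s u| <= m.+1%:R * `|n t0| * expR (- (H u - H t0)).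
    have -> : s u = expR (- (H u - H t0)) * r u.
      by rewrite rE ?(ltW t0u)// mulrA /h -expRD addNr expR0 mul1r.
    rewrite normrM (gtr0_norm (expR_gt0 _)) mulrC ler_wpM2r ?expR_ge0//.
    have := sliding_norm_nonincreasing gam t0 gam_ge0 r t0 u sliding_r
      (lexx _) (ltW t0u).
    move=> /le_trans; apply.
    by rewrite r0 (le_trans dotv_n0_le)// -[leRHS]mulr1 ler_wpM2l.
  have sg : `|sigma eps (b u)| <= 1.
    rewrite /sigma normrM normfV (gtr0_norm (den_gt0 u)) ler_pdivrMr//.
    by rewrite mul1r lerDl ltW.
  rewrite normrM normrN -[leRHS]mul1r ler_pM//.
  rewrite (le_trans (ler_normD _ _))// !normrM lerD//.
    rewrite gtr0_norm// -[leRHS]mulr1 ler_wpM2l ?(ltW k1_gt0)//.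
    exact: filippov_sign_norm _ _ sv.
  by rewrite ler_wpM2l.
rewrite -/(y t); apply: mx_norm_le => [|i j].
  by rewrite addr_ge0// mulr_ge0// subr_ge0.
rewrite (ord1 j) -(subrK (y t0 i 0) (y t i 0)) addrC (le_trans (ler_normD _ _))//.
by rewrite lerD// y0 mx_entry_norm.
Qed.

End Solution.

Let velocity_bound_cont : continuous velocity_bound.
Proof.
move=> t; apply: cvgM; first exact: cvg_cst.
apply: cvgM; first by apply: cvg_norm; exact: continuous_trmx.
apply: cvgM; last by apply: cvg_norm; exact: B_cont.
apply: cvgD; first exact: cvg_cst.
do 2![apply: cvgM; first exact: cvg_cst].
exact: is_derive_continuous _ _ _ (is_derive_expf _ _ _ (is_derive_oppf _ _ _
  (is_derive_subf _ _ _ _ _ (dH t) (is_derive_cstf t (H t0))))).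
Qed.

Let vanishing_bounded (f : R -> R) : continuous f -> f t @[t --> +oo] --> (0 : R) ->
  exists2 K, 0 < K & forall t, t0 <= t -> `|f t| <= K.
Proof.
move=> fc /cvgrPdist_lt/(_ 1 ltr01)[M [_ fM]].
have [K K0 fK] := within_continuous_bounded f t0 (M + 1) (continuous_subspaceT fc).
exists (K + 1) => [|t t0t]; first by rewrite ltr_wpDl// ltW.
have [tM|Mt] := leP t (M + 1).
  by rewrite (le_trans (fK t t0t tM))// lerDl.
have := fM t; rewrite sub0r normrN => /(_ _)/ltW H1.
rewrite (le_trans (H1 _)) ?lerDr ?(ltW K0)//.
by rewrite (lt_trans _ Mt)// ltrDl.
Qed.

(* [1 - n n^T] projects onto the stable plane, so the columns of the product
   below are solutions of the unforced system that tend to [0]. *)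
Let plane_bound : exists2 M, 0 < M & forall t z, t0 <= t ->
  dotv (n t0) z = 0 -> `|X t *m z| <= M * `|z|.
Proof.
pose Q := 1%:M - n t0 *m (n t0)^T.
have nQ : (n t0)^T *m Q = 0.
  rewrite mulmxBr mulmx1 mulmxA.
  have -> : (n t0)^T *m n t0 = 1%:M.
    by apply/matrixP => i j; rewrite !ord1 [in RHS]mxE eqxx; exact: n_unit.
  by rewrite mul1mx subrr.
have Qz (z : 'cV[R]_m.+1) : dotv (n t0) z = 0 -> Q *m z = z.
  move=> nz; rewrite mulmxBl mul1mx -mulmxA.
  have -> : (n t0)^T *m z = 0.
    by apply/matrixP => i j; rewrite !ord1 [RHS]mxE; exact: nz.
  by rewrite mulmx0 subr0.
pose W t := X t *m Q.
have Wc i j : continuous (fun t => W t i j).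
  apply: (continuous_mxP _ _ _ _).1; apply: continuous_mulmx => // t.
  exact: cvg_cst.
have W0 i j : W t i j @[t --> +oo] --> (0 : R).
  have SQ : orth_plane n t0 (X t0 *m col j Q).
    by rewrite /orth_plane/= X0 mul1mx /dotv colE mulmxA nQ mul0mx mxE.
  have [_ /cvg_mxP/(_ i 0)] := S_inv t0 _
    (fundamental_solution A X t0 Xc dX t0 (col j Q) (lexx _)) SQ.
  rewrite mxE; apply: cvg_trans; apply: near_eq_cvg; apply: nearW => t.
  by rewrite /W colE mulmxA -colE mxE.
have /choice[K KP] : forall ij, exists K, 0 < K /\
    forall t, t0 <= t -> `|W t ij.1 ij.2| <= K.
  move=> [i j]; have [K K0 WK] := vanishing_bounded _ (Wc i j) (W0 i j).
  by exists K.
pose M := \sum_ij K ij.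
have KM ij : K ij <= M.
  by rewrite /M (bigD1 ij)//= lerDl sumr_ge0// => kl _; have [/ltW] := KP kl.
have M0 : 0 < M by apply: lt_le_trans (KM (0, 0)); have [] := KP (0, 0).
exists (m.+1%:R * M) => [|t z t0t nz]; first by rewrite mulr_gt0.
rewrite -{1}(Qz z nz) mulmxA -mulrA (le_trans (mulmx_norm_le _ _ _ _ _))//.
rewrite ler_wpM2l// ler_wpM2r// mx_norm_le ?ltW// => i j.
by have [_ WK] := KP (i, j); apply: le_trans (WK t t0t) (KM _).
Qed.

Lemma closed_loop_stable e : 0 < e -> exists2 d, 0 < d &
  forall x, inclusion_solution F t0 x -> `|x t0| < d ->
    forall t, t0 <= t -> `|x t| < e.
Proof.
move=> e0.
have [M M0 XM] := plane_bound.
have t01 : t0 <= t0 + 1 by rewrite lerDl.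
have [C C0 VC] := within_continuous_bounded velocity_bound t0 (t0 + 1)
  (continuous_subspaceT velocity_bound_cont).
have Xnc : continuous (fun t => `|X t|) by move=> t; apply: cvg_norm; exact: Xc.
have [N N0 XN] := within_continuous_bounded _ t0 (t0 + 1) (continuous_subspaceT Xnc).
(* One constant serves both phases: the first summand bounds [X] before [t1], the second bounds it
   on the stable plane afterwards. *)
pose Q := m.+1%:R * N + M.
have Q0 : 0 < Q by rewrite addr_gt0// mulr_gt0.
(* The reaching time is fixed before [d]: short enough that the drift costs at most [e / 4], and at
   most 1 so that [C] and [N] apply. *)
pose eta := Order.min 1 (e / (4 * Q * C)).
have eta0 : 0 < eta by rewrite lt_min ltr01 divr_gt0// !mulr_gt0.
pose t1 := t0 + eta.
have t0t1 : t0 < t1 by rewrite ltrDl.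
have t1t0 : t1 <= t0 + 1 by rewrite lerD2l ge_min lexx.
pose L := m.+1%:R * `|n t0| + 1.
have L0 : 0 < L by rewrite ltr_wpDl// mulr_ge0.
(* The three bounds serve, in order, the drift estimate, an initial contribution below [e / 4], and
   the vanishing of [s] by time [t1]. *)
pose d := Order.min 1 (Order.min (e / (4 * Q)) ((G t1 - G t0) / L)).
exists d.
  rewrite !lt_min ltr01 !divr_gt0 ?mulr_gt0//=.
  by rewrite subr_gt0 G_strict.
move=> x Fx; rewrite !lt_min => /and3P[x1 xe xG] t t0t.
have sG : `|dotv (n t0) (x t0)| <= G t1 - G t0.
  rewrite (le_trans (dotv_norm_le _ _))//.
  move: xG; rewrite ltr_pdivlMr// => /ltW; apply: le_trans.
  by rewrite mulrA mulrC ler_wpM2l// lerDl.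
have drift u : t0 <= u -> u <= t1 -> Q * `|(P u)^T *m x u| < e.
  move=> t0u ut1.
  have VC1 w : t0 <= w -> w <= t1 -> velocity_bound w <= C.
    by move=> t0w wt1; apply: le_trans (ler_norm _) (VC w t0w (le_trans wt1 t1t0)).
  have := adjoint_state_drift x Fx t1 C t0t1 (ltW x1) VC1 u t0u ut1.
  have Ceta : Q * (C * (u - t0)) <= e / 4.
    rewrite (le_trans (_ : _ <= Q * (C * eta)))//.
      by rewrite ler_pM2l// ler_pM2l// lerBlDl.
    have : eta <= e / (4 * Q * C) by rewrite ge_min lexx orbT.
    by rewrite ler_pdivlMr ?mulr_gt0//; lra.
  have xQ : Q * `|x t0| < e / 4.
    by move: xe; rewrite ltr_pdivlMr ?mulr_gt0//; lra.
  rewrite -(ler_pM2l Q0) => /le_lt_trans; apply.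
  by rewrite mulrDr; lra.
have [tt1|/ltW t1t] := leP t t1.
  apply: le_lt_trans (drift t t0t tt1).
  rewrite {1}(fundamental_adjoint x t t0t).
  rewrite (le_trans (mulmx_norm_le _ _ _ _ _))// mulrA ler_wpM2r//.
  apply: (@le_trans _ _ (m.+1%:R * N)); last by rewrite /Q lerDl ltW.
  rewrite ler_wpM2l//.
  by have := XN t t0t (le_trans tt1 t1t0); rewrite normr_id.
apply: le_lt_trans (drift t1 (ltW t0t1) (lexx _)).
rewrite {1}(sliding_exit x Fx t1 t t0t1 sG t1t).
rewrite (le_trans (XM t _ t0t _))//; last first.
  by rewrite ler_wpM2r// /Q lerDr mulr_ge0// ltW.
rewrite dotv_mulmxr trmxK adjoint_n ?ltW// dotvZl.
by rewrite (reached x Fx t1 t1) ?mulr0.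
Qed.

End System.

Theorem theorem1 (R : realType) (T : R) (T_gt0 : 0 < T)
    (A : R -> 'M[R]_3) (B : R -> 'cV[R]_3)
    (A_cont : continuous A) (B_cont : continuous B)
    (A_per : periodic A T) (B_per : periodic B T)
    (n : R -> 'cV[R]_3) (n_cont : continuous n)
    (n_unit : forall t, unit_sphere (n t))
    (S_per : forall t, orth_plane n (t + T) = orth_plane n t)
    (S_inv : stable_invariant A (orth_plane n))
    (b : R -> R) (b_def : forall t, b t = dotv (n t) (B t))
    (b_fin : finite_set [set t | t \in `[0, T] /\ b t = 0])
    (b_simple : forall t, t \in `[0, T] -> b t = 0 ->
       derivable b t 1 /\ derive1 b t != 0)
    (eps k1 k2 : R) (eps_gt0 : 0 < eps) (k1_gt0 : 0 < k1)
    (k2_gt : (\int[lebesgue_measure]_(t in `[0, T]) dotv (n t) (A t *m n t)) /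
             (\int[lebesgue_measure]_(t in `[0, T]) (b t * sigma eps (b t)))
             < k2) :
  globally_asymptotically_stable
    (closed_loop A B (feedback B n eps k1 k2)).
Proof.
have n1 t : dotv (n t) (n t) = 1 by exact: unit_sphere_dotv.
have gc := gain_cont B n b eps B_cont n_cont b_def eps_gt0.
have ac := growth_cont A n A_cont n_cont.
have [g dg] := antiderivative _ gc.
have [alpha dalpha] := antiderivative _ ac.
have k2_gt' : (alpha T - alpha 0) / (g T - g 0) < k2.
  by rewrite -(Rintegral_primitive alpha _ 0 T T_gt0 ac dalpha)
    -(Rintegral_primitive g _ 0 T T_gt0 gc dg).
(* Periodicity bounds [A] uniformly, as the global Picard contraction requires. *)
have [K AK] : exists K, forall t, `|A t| <= K.
  have Anc : continuous (fun t => `|A t|).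
    by move=> t; apply: cvg_norm; exact: A_cont.
  have [|K AK] := continuous_periodic_bounded _ T T_gt0 Anc.
    by move=> t; rewrite A_per.
  by exists K => t; have := AK t; rewrite normr_id.
have NAc : continuous (fun t => - (A t)^T).
  by move=> t; apply: cvgN; exact: continuous_trmx.
have NAK t : `|- (A t)^T| <= K.
  rewrite normrN mx_norm_le ?(le_trans _ (AK t))// => i j.
  by rewrite mxE (le_trans (mx_entry_norm _ _ _ _ _)).
(* [X], [P] and [G] are built anew for each initial time; the radius [d] may depend on [t0]. *)
have system t0 : (forall e, 0 < e -> exists2 d, 0 < d & forall x,
      inclusion_solution (closed_loop A B (feedback B n eps k1 k2)) t0 x ->
      `|x t0| < d -> forall t, t0 <= t -> `|x t| < e) /\
    forall x, inclusion_solution (closed_loop A B (feedback B n eps k1 k2)) t0 x ->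
      x t @[t --> +oo] --> (0 : 'cV[R]_3).
  have [X [Xc X0 dX]] := fundamental_matrix A K t0 A_cont AK.
  have [P [Pc P0 dP]] := fundamental_matrix _ K t0 NAc NAK.
  have [G dG] := antiderivative _ (sliding_rate_cont A B n b eps k1 k2 B_cont n_cont
    b_def eps_gt0 g alpha dg dalpha t0).
  split=> [e e0|x Fx].
    exact: (closed_loop_stable T A B n b eps k1 k2 T_gt0 A_cont B_cont B_per n_cont
      n1 S_per S_inv b_def b_simple eps_gt0 k1_gt0 g alpha dg dalpha t0 G dG
      X P Xc X0 dX Pc P0 dP e e0).
  exact: (closed_loop_attractive T A B n b eps k1 k2 T_gt0 A_cont B_cont A_per B_per
    n_cont n1 S_per S_inv b_def b_simple eps_gt0 k1_gt0 g alpha dg dalpha k2_gt'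
    t0 G dG X P Xc X0 dX Pc P0 dP x Fx).
split=> [t0 e e0|t0 x0 x Fx _].
  by have [+ _] := system t0; exact.
by have [_] := system t0; exact.
Qed.
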